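(* Let $T$ be an ergodic automorphism of a standard probability Borel space $(X,\mathcal{B},\mu)$. If $T$ has the CS($n$) property for some $n\geq 2$, then $T$ has the JP($n-1$) property.
   Context: An automorphism is an invertible measure-preserving transformation of a standard probability Borel space. Its Koopman operator is $U_T f=f\circ T$ on $L^2(X,\mathcal{B},\mu)$, and the maximal spectral type $\sigma_T$ of $T$ is the maximal spectral type (a measure class on the circle $\mathbb{T}=\{z\in\mathbb{C}:|z|=1\}$) of the unitary operator $U_T$. All measures on $\mathbb{T}$ are positive finite Borel measures; continuous means having no atoms. CS($n$) (convolution singularity of order $n$): a measure $\sigma$ on $\mathbb{T}$ has the CS($n$) property if $\sigma\perp\nu_1\ast\dots\ast\nu_n$ for any continuous measures $\nu_1,\dots,\nu_n$ on $\mathbb{T}$. An automorphism has the CS($n$) property if its maximal spectral type does. Joinings: for automorphisms $T$ of $(X,\mathcal{B},\mu)$ and $S$ of $(Y,\mathcal{C},\nu)$, $J^e(T,S)$ denotes the set of ergodic $T\times S$-invariant probability measures on $X\times Y$ with marginals $\mu$ and $\nu$. JP($n$) (joining primeness of order $n\ge 1$): an ergodic automorphism $T$ of $(X,\mathcal{B},\mu)$ has the JP($n$) property if for any $k\geq n+1$, any weakly mixing automorphisms $S_i$ of standard probability Borel spaces $(Y_i,\mathcal{C}_i,\nu_i)$, $1\leq i\leq k$, and every $\lambda\in J^e(T,S_1\times\dots\times S_k)$, there exist indices $i_1,\dots,i_n\in\{1,\dots,k\}$ such that $\lambda=\lambda_{X,Y_{i_1},\dots,Y_{i_n}}\otimes\bigotimes_{j\notin\{i_1,\dots,i_n\}}\nu_j$,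 where $\lambda_{X,Y_{i_1},\dots,Y_{i_n}}$ is the projection of $\lambda$ on the product of the corresponding coordinate spaces. *)

(* Defs.v *)
From HB Require Import structures.
From mathcomp Require Import all_boot all_order all_algebra.
From mathcomp Require Import complex.
From mathcomp Require Import all_classical all_reals all_analysis.

Set Implicit Arguments.
Unset Strict Implicit.
Unset Printing Implicit Defensive.
Import Order.TTheory GRing.Theory Num.Theory.
Import numFieldNormedType.Exports.

Local Open Scope classical_set_scope.
Local Open Scope ring_scope.

Section FiniteProduct.
Context {I : finType} {d : I -> measure_display}.
Variable Y : forall i, measurableType (d i).

Definition cylinder : set (set (forall i, Y i)) :=
  [set C | exists i (B : set (Y i)),
    measurable B /\ C = (fun y : forall i, Y i => y i) @^-1` B].

(* The product [forall i, Y i] with the product sigma-algebra. *)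
Definition dprod := g_sigma_algebraType cylinder.

Lemma measurable_coord i : measurable_fun setT (fun y : dprod => y i).
Proof.
by move=> _ B mB; rewrite setTI; apply: sub_sigma_algebra; exists i, B.
Qed.

Lemma measurable_to_dprod d' (Z : measurableType d') (f : Z -> dprod) :
  (forall i, measurable_fun setT (fun z => f z i)) -> measurable_fun setT f.
Proof.
move=> mf; apply: (@measurability _ _ _ _ setT f cylinder) => //.
move=> _ [_ [i [B [mB ->]]] <-].
exact: (mf i measurableT B mB).
Qed.

Lemma measurable_box (A : forall i, set (Y i)) :
  (forall i, measurable (A i)) ->
  measurable ([set y | forall i, A i (y i)] : set dprod).
Proof.
move=> mA; rewrite (_ : [set y | _] =
    \bigcap_i ((fun y : dprod => y i) @^-1` A i)); last first.
  by apply/seteqP; split=> y /= yA; [move=> i _|move=> i]; exact: yA.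
apply: fin_bigcap_measurable; first exact: finite_finset.
by move=> i _; rewrite -[X in measurable X]setTI; exact: measurable_coord.
Qed.

Definition set_coord (i : I) (p : Y i * dprod) : dprod :=
  dfwith p.2 i p.1.

Lemma measurable_set_coord i : measurable_fun setT (@set_coord i).
Proof.
apply: measurable_to_dprod => j; rewrite /set_coord.
case: (eqVneq i j) => [<-|ij].
  rewrite (_ : (fun z => _) = fst); first exact: measurable_fst.
  by apply/funext => z; rewrite dfwithin.
rewrite (_ : (fun z => _) = (fun y : dprod => y j) \o snd).
  by apply: measurableT_comp; [exact: measurable_coord|exact: measurable_snd].
by apply/funext => z; rewrite dfwithout.
Qed.

Context {R : realType}.

Section Resample.
Variables (i : I) (m1 : {finite_measure set (Y i) -> \bar R}).
Variable m : {finite_measure set dprod -> \bar R}.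

(* Replaces the i-th coordinate of m by an independent one of law m1. *)
Definition resample := pushforward (m1 \x m)%E (@set_coord i).

Let mset_coord := @measurable_set_coord i.

Let resample0 : resample set0 = 0%E.
Proof. exact: measure0. Qed.

Let resample_ge0 A : (0 <= resample A)%E.
Proof. exact: measure_ge0. Qed.

Let resample_sigma_additive : semi_sigma_additive resample.
Proof. exact: measure_semi_sigma_additive. Qed.

HB.instance Definition _ := isMeasure.Build _ _ _ resample
  resample0 resample_ge0 resample_sigma_additive.

Let resample_fin : fin_num_fun resample.
Proof.
apply: lty_fin_num_fun.
rewrite [X in (X < _)%E](_ : _ = (m1 \x m)%E (setT `*` setT)); last first.
  by rewrite setXTT.
by rewrite product_measure1E// ltey_eq fin_numM// fin_num_measure.
Qed.

HB.instance Definition _ := Measure_isFinite.Build _ _ _ resample resample_fin.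

End Resample.

Variable nu : forall i, {finite_measure set (Y i) -> \bar R}.

(* The product measure: each coordinate of an arbitrary Dirac mass is resampled
   once; characterized by prodm_box. *)
Definition prodm : {finite_measure set dprod -> \bar R} :=
  foldr (fun i m => resample (nu i) m : {finite_measure set dprod -> \bar R})
    (dirac (point : dprod) : {finite_measure set dprod -> \bar R}) (enum I).

Lemma prodm_box (A : forall i, set (Y i)) : (forall i, measurable (A i)) ->
  prodm [set y | forall i, A i (y i)] = (\prod_(i : I) nu i (A i))%E.
Proof.
have : forall j, j \notin enum I -> A j = setT.
  by move=> j; rewrite mem_enum.
have := enum_uniq I.
rewrite /prodm -big_enum/=.
elim: (enum I) A => [|i s IHs] A /=.
  move=> _ AT mA; rewrite big_nil diracE mem_set// => j.
  by rewrite AT.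
move=> /andP[si us] AT mA; rewrite big_cons /resample /pushforward.
set m := foldr _ _ _ in IHs *.
pose B j := if j == i then setT else A j.
rewrite (_ : _ @^-1` _ = A i `*` [set y | forall j, B j (y j)]); last first.
  apply/seteqP; split=> [[x y]/= h|[x y]/= [Ax By] j].
    split=> [|j]; first by have := h i; rewrite /set_coord dfwithin.
    rewrite /B; case: eqVneq => // ji.
    by have := h j; rewrite /set_coord dfwithout// eq_sym.
  rewrite /set_coord; case: (eqVneq i j) => [<-|ij]; first by rewrite dfwithin.
  by rewrite dfwithout//; have := By j; rewrite /B eq_sym (negbTE ij).
have mB j : measurable (B j) by rewrite /B; case: ifP.
rewrite product_measure1E//; last exact: measurable_box.
congr (_ * _)%E; rewrite [LHS](IHs B us _ mB); last first.
  move=> j js; rewrite /B; case: eqVneq => // ji.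
  by apply: AT; rewrite inE negb_or ji.
apply: eq_big_seq => j js; rewrite /B; case: eqVneq => // ji.
by move: si; rewrite -ji js.
Qed.

End FiniteProduct.

Section Systems.
Context {R : realType}.

(* Borel isomorphic to a Polish space. *)
Definition standard_borel d (X : measurableType d) :=
  exists (M : completePseudoMetricType R) (phi : X -> M),
    [/\ hausdorff_space M, @second_countable M, bijective phi &
        forall A : set X, measurable A <-> <<s [set U : set M | open U] >> (phi @` A)].

Record automorphism d (X : measurableType d) (mu : probability X R) := {
  aut_fun :> X -> X;
  aut_inv : X -> X;
  aut_funK : cancel aut_fun aut_inv;
  aut_invK : cancel aut_inv aut_fun;
  measurable_aut_fun : measurable_fun setT aut_fun;
  measurable_aut_inv : measurable_fun setT aut_inv;
  aut_preserving : forall A, measurable A -> mu (aut_fun @^-1` A) = mu A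
}.

Definition aut_iter d (X : measurableType d) (mu : probability X R)
    (T : automorphism mu) (k : int) : X -> X :=
  match k with
  | Posz n => iter n T
  | Negz n => iter n.+1 (aut_inv T)
  end.

Definition ergodic d (X : measurableType d) (mu : set X -> \bar R)
    (f : X -> X) :=
  forall A, measurable A -> f @^-1` A = A -> mu A = 0%E \/ mu (~` A) = 0%E.

Definition prod_map {X Y : Type} (f : X -> X) (g : Y -> Y) (p : X * Y) :=
  (f p.1, g p.2).

Definition dprod_map (I : finType) (d : I -> measure_display)
    (Y : forall i, measurableType (d i)) (f : forall i, Y i -> Y i)
    (y : dprod Y) : dprod Y :=
  fun i => f i (y i).

Definition weakly_mixing d (X : measurableType d) (mu : probability X R)
    (T : automorphism mu) :=
  ergodic (mu \x mu)%E (prod_map T T).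

(* J^e(f, g) for a transformation f of (X, mu) and g of (Y, nu). *)
Definition ergodic_joining d d' (X : measurableType d) (Y : measurableType d')
    (mu : set X -> \bar R) (f : X -> X) (nu : set Y -> \bar R) (g : Y -> Y)
    (lambda : probability (X * Y)%type R) :=
  [/\ forall A, measurable A -> lambda (fst @^-1` A) = mu A,
      forall B, measurable B -> lambda (snd @^-1` B) = nu B,
      forall C, measurable C -> lambda (prod_map f g @^-1` C) = lambda C &
      ergodic lambda (prod_map f g)].

Definition subfamily (I : finType) (d : I -> measure_display)
    (Y : forall i, measurableType (d i)) (J : {set I})
    (j : {i : I | i \in J}) : measurableType (d (val j)) := Y (val j).

Definition restr (I : finType) (d : I -> measure_display)
    (Y : forall i, measurableType (d i)) (J : {set I}) (y : dprod Y) :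
    dprod (subfamily Y (J := J)) :=
  fun j => y (val j).

Arguments restr {I d Y} J y.
Arguments subfamily {I d} Y J j.

(* lambda = lambda_{X, Y_J} (x) (x)_{i \notin J} nu_i, after regrouping the
   coordinates as (X * \prod_(i in J) Y i) * \prod_(i notin J) Y i. *)
Definition splits_along (I : finType) (d : I -> measure_display)
    (Y : forall i, measurableType (d i)) (nu : forall i, probability (Y i) R)
    d' (X : measurableType d') (lambda : probability (X * dprod Y)%type R)
    (J : {set I}) :=
  let proj_J (p : X * dprod Y) := (p.1, restr J p.2) in
  let regroup (p : X * dprod Y) := (proj_J p, restr (~: J) p.2) in
  forall E, measurable E ->
    pushforward lambda regroup E =
    (pushforward lambda proj_J \x
       prodm (fun j : {i : I | i \in ~: J} => nu (val j)))%E E.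

Definition JP (n : nat) d (X : measurableType d) (mu : probability X R)
    (T : automorphism mu) :=
  forall (k : nat), (n.+1 <= k)%N ->
  forall (dY : 'I_k -> measure_display)
    (Y : forall i, measurableType (dY i))
    (nu : forall i, probability (Y i) R)
    (S : forall i, automorphism (nu i)),
  (forall i, standard_borel (Y i)) ->
  (forall i, weakly_mixing (S i)) ->
  forall lambda : probability (X * dprod Y)%type R,
  ergodic_joining mu T (prodm nu) (dprod_map S) lambda ->
  exists J : {set 'I_k}, #|J| = n /\ splits_along nu lambda J.

End Systems.

Section Circle.
Variable R : realType.

Definition circle := {z : R[i] | `|z| == 1}.

Definition circle_one : circle := exist _ 1 (introT eqP (normr1 _)).

Lemma circle_mul_subproof (z w : circle) : `|val z * val w| == 1.
Proof. by rewrite normrM (eqP (valP z)) (eqP (valP w)) mulr1. Qed.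

Definition circle_mul (z w : circle) : circle :=
  exist _ (val z * val w) (circle_mul_subproof z w).

HB.instance Definition _ := Choice.on circle.
HB.instance Definition _ := isPointed.Build circle circle_one.

(* The subspace topology inherited from the plane. *)
Definition circle_open : set (set circle) :=
  [set (fun z => (complex.Re (val z), complex.Im (val z))) @^-1` U
     | U in [set U : set (R * R) | open U]].

Definition circleB := g_sigma_algebraType circle_open.

End Circle.

Section Spectral.
Context {R : realType}.
Local Notation C := R[i].

Definition cintegral d (X : measurableType d)
    (m : {measure set X -> \bar R}) (h : X -> C) : C :=
  Complex (\int[m]_x complex.Re (h x)) (\int[m]_x complex.Im (h x)).

Definition L2 d (X : measurableType d) (m : {measure set X -> \bar R})
    (f : X -> C) :=
  [/\ measurable_fun setT (fun x => complex.Re (f x)),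
      measurable_fun setT (fun x => complex.Im (f x)) &
      m.-integrable setT
        (fun x => (complex.Re (f x) ^+ 2 + complex.Im (f x) ^+ 2)%:E)].

(* sigma is the spectral measure of f for the Koopman operator U of T:
   its k-th Fourier coefficient is the inner product <U^k f, f>. *)
Definition is_spectral_measure d (X : measurableType d) (mu : probability X R)
    (T : automorphism mu) (f : X -> C)
    (sigma : {finite_measure set (circleB R) -> \bar R}) :=
  forall k : int,
    cintegral sigma (fun z : circleB R => val z ^ k) =
    cintegral mu (fun x => f (aut_iter T k x) * (f x)^*).

(* The maximal spectral type is a measure class; this says that sigma is one
   of its representatives. *)
Definition is_max_spectral_type d (X : measurableType d) (mu : probability X R)
    (T : automorphism mu)
    (sigma : {finite_measure set (circleB R) -> \bar R}) :=
  (forall f tau, L2 mu f -> is_spectral_measure T f tau -> tau `<< sigma) /\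
  (exists f tau, [/\ L2 mu f, is_spectral_measure T f tau & sigma `<< tau]).

Definition continuous_measure
    (nu : {finite_measure set (circleB R) -> \bar R}) :=
  forall z : circleB R, nu [set z] = 0%E.

Definition convolution n
    (nu : 'I_n -> {finite_measure set (circleB R) -> \bar R}) :=
  pushforward (prodm nu) (fun z : dprod (fun _ : 'I_n => circleB R) =>
    \big[@circle_mul R/circle_one R]_(i < n) z i : circleB R).

Definition mutually_singular d (X : measurableType d) (m1 m2 : set X -> \bar R) :=
  exists A, [/\ measurable A, m1 A = 0%E & m2 (~` A) = 0%E].

Definition CS_measure n (sigma : {finite_measure set (circleB R) -> \bar R}) :=
  forall nu : 'I_n -> {finite_measure set (circleB R) -> \bar R},
    (forall i, continuous_measure (nu i)) ->
    mutually_singular sigma (convolution nu).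

Definition CS n d (X : measurableType d) (mu : probability X R)
    (T : automorphism mu) :=
  exists sigma, is_max_spectral_type T sigma /\ CS_measure n sigma.

End Spectral.

(* Main.v *)
From HB Require Import structures.
Require Import Defs.
From mathcomp Require Import all_boot all_order all_algebra.
From mathcomp Require Import complex.
From mathcomp Require Import all_classical all_reals all_analysis.
From mathcomp Require Import measurable_realfun.
From mathcomp Require Import zify ring lra.

(** Call a set [L] of coordinates correlated when the conditional expectation
    on [Y_1 x ... x Y_k] of some bounded function on [X] has a nonzero component
    in the tensor product of the spaces of mean-zero functions of the [y_i],
    [i] in [L].  The theorem follows from two facts.

    - A correlated set has fewer than [n] elements: the spectral measure of a
      product of mean-zero functions over [L] is a convolution of [#|L|]
      continuous measures, hence singular to the maximal spectral type of [T]
      when [n <= #|L|], and vectors with mutually singular spectral measures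
      are orthogonal.
    - The union of two correlated sets [J], [K] is correlated.  If [f], [u] and
      [g], [h] witness the correlation of [J] and [K], the ergodicity of the
      joining gives infinitely many [m] for which [f * (g o T^m)] correlates
      with [u * (h o S^m)], while by weak mixing the latter is for most [m]
      close to a pure tensor of mean-zero functions over [J :|: K].

    So all correlated sets lie in a single one, of cardinality less than [n],
    and [lambda] does not see the other coordinates. *)

Set Implicit Arguments.
Unset Strict Implicit.
Unset Printing Implicit Defensive.
Import Order.TTheory GRing.Theory Num.Theory.
Import numFieldNormedType.Exports.

Local Open Scope classical_set_scope.
Local Open Scope ring_scope.

(** * Integrals of bounded measurable functions *)

Section BoundedMeasurable.
Context {R : realType} {d} {T : measurableType d}.
Implicit Types f g : T -> R.

(** No conditional expectation is ever formed. Correlation is tested by integrating a function of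
    [x] against pure products [\prod_i u i (y i)]; this suffices because the indicator of a box is
    such a product, each of its factors being a constant plus a mean-zero function, and boxes
    determine [lambda]. All functions are real and bounded: products then raise no question of
    integrability, and correlation sequences are real and even, so that positive definiteness is a
    statement about cosine sums.

    The hypothesis on [T] says something about a function only once a spectral measure of it is
    given, and it applies only to continuous measures. Both have to be produced: Herglotz's theorem
    constructs spectral measures from correlation sequences, and Wiener's lemma turns the averaged
    decay of correlations under weak mixing into the absence of atoms. As [CS n] concerns exactly
    [n] measures, a correlated set with at least [n] elements is cut into exactly [n] blocks, each
    contributing one continuous measure. *)

Definition bmeas f :=
  measurable_fun setT f /\ exists M, forall x, `|f x| <= M.

Lemma bmeas_gt0_bound f : bmeas f -> exists2 M, 0 < M & forall x, `|f x| <= M.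
Proof.
move=> [_ [M fM]]; exists (`|M| + 1); first by rewrite ltr_pwDr.
by move=> x; rewrite (le_trans (fM x))// (le_trans (ler_norm _))// lerDl.
Qed.

Lemma bmeas_cst c : bmeas (fun=> c).
Proof. by split; [exact: measurable_cst|exists `|c|]. Qed.

Lemma bmeasD f g : bmeas f -> bmeas g -> bmeas (fun x => f x + g x).
Proof.
move=> [mf [M fM]] [mg [N gN]]; split; first exact: measurable_funD.
by exists (M + N) => x; rewrite (le_trans (ler_normD _ _))// lerD.
Qed.

Lemma bmeasM f g : bmeas f -> bmeas g -> bmeas (fun x => f x * g x).
Proof.
move=> [mf [M fM]] [mg [N gN]]; split; first exact: measurable_funM.
by exists (M * N) => x; rewrite normrM ler_pM.
Qed.

Lemma bmeasZ c f : bmeas f -> bmeas (fun x => c * f x).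
Proof. by apply: bmeasM; exact: bmeas_cst. Qed.

Lemma bmeasN f : bmeas f -> bmeas (fun x => - f x).
Proof.
move=> /(bmeasZ (-1)); congr bmeas; apply/funext => x; exact: mulN1r.
Qed.

Lemma bmeasB f g : bmeas f -> bmeas g -> bmeas (fun x => f x - g x).
Proof. by move=> bf bg; apply: bmeasD => //; exact: bmeasN. Qed.

Lemma bmeas_norm f : bmeas f -> bmeas (fun x => `|f x|).
Proof.
move=> [mf [M fM]]; split; first exact: measurableT_comp.
by exists M => x; rewrite normr_id.
Qed.

Lemma bmeas_sum (I : Type) (s : seq I) (P : pred I) (F : I -> T -> R) :
  (forall i, P i -> bmeas (F i)) -> bmeas (fun x => \sum_(i <- s | P i) F i x).
Proof.
move=> bF; elim: s => [|i s IHs].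
  by under eq_fun do rewrite big_nil; exact: bmeas_cst.
under eq_fun do rewrite big_cons.
case: (boolP (P i)) => Pi; last exact: IHs.
by apply: bmeasD => //; exact: bF.
Qed.

Lemma bmeas_prod (I : Type) (s : seq I) (P : pred I) (F : I -> T -> R) :
  (forall i, P i -> bmeas (F i)) -> bmeas (fun x => \prod_(i <- s | P i) F i x).
Proof.
move=> bF; elim: s => [|i s IHs].
  by under eq_fun do rewrite big_nil; exact: bmeas_cst.
under eq_fun do rewrite big_cons.
case: (boolP (P i)) => Pi; last exact: IHs.
by apply: bmeasM => //; exact: bF.
Qed.

Lemma bmeas_indic (A : set T) : measurable A -> bmeas (\1_A).
Proof.
move=> mA; split; first exact: measurable_indic.
by exists 1 => x; rewrite ger0_norm ?indicE//; case: (x \in A); rewrite //= lexx.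
Qed.

Lemma bmeas_integrable (m : {finite_measure set T -> \bar R}) f :
  bmeas f -> m.-integrable setT (EFin \o f).
Proof.
move=> [mf [M fM]]; apply: measurable_bounded_integrable => //.
  by rewrite ltey_eq fin_num_measure.
exists M; split; first by rewrite num_real.
by move=> N MN x _; exact: le_trans (fM x) (ltW MN).
Qed.

Lemma bmeas_cvg (f_ : (T -> R)^nat) f M : (forall n, bmeas (f_ n)) ->
  (forall n x, `|f_ n x| <= M) -> (forall x, f_ n x @[n --> \oo] --> f x) ->
  bmeas f.
Proof.
move=> bf fM cf; split.
  refine (@measurable_fun_cvg _ _ _ setT f_ f _ (fun x _ => cf x)).
  by move=> n; have [] := bf n.
exists M => x.
have : `|f_ n x| @[n --> \oo] --> `|f x| by apply: cvg_norm; exact: cf.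
move=> /cvg_lim <-//; apply: limr_le => //.
  by apply/cvg_ex; exists `|f x|; apply: cvg_norm; exact: cf.
by apply: nearW => n.
Qed.

End BoundedMeasurable.

Lemma bmeas_comp {R : realType} d d' (T : measurableType d)
  (T' : measurableType d') (f : T -> R) (h : T' -> T) :
  bmeas f -> measurable_fun setT h -> bmeas (fun x => f (h x)).
Proof.
move=> [mf [M fM]] mh; split; first exact: measurableT_comp.
by exists M.
Qed.

Section Expectation.
Context {R : realType} {d} {T : measurableType d}.
Variable m : {finite_measure set T -> \bar R}.
Implicit Types f g : T -> R.
Local Notation E f := (Rintegral m setT f).

Lemma eq_Rint f g : f =1 g -> E f = E g.
Proof. by move=> fg; apply: eq_Rintegral => x _. Qed.

Lemma RintD f g : bmeas f -> bmeas g -> E (fun x => f x + g x) = E f + E g.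
Proof. by move=> *; rewrite RintegralD//; exact: bmeas_integrable. Qed.

Lemma RintB f g : bmeas f -> bmeas g -> E (fun x => f x - g x) = E f - E g.
Proof. by move=> *; rewrite RintegralB//; exact: bmeas_integrable. Qed.

Lemma RintZ c f : bmeas f -> E (fun x => c * f x) = c * E f.
Proof. by move=> *; rewrite RintegralZl//; exact: bmeas_integrable. Qed.

Lemma Rint_cst c : E (fun=> c) = c * fine (m setT).
Proof. exact: Rintegral_cst. Qed.

Lemma Rint0 : E (fun=> 0) = 0.
Proof. by rewrite Rint_cst mul0r. Qed.

Lemma RintN f : bmeas f -> E (fun x => - f x) = - E f.
Proof.
move=> bf; rewrite -[RHS]mulN1r -RintZ//; apply: eq_Rint => x.
by rewrite mulN1r.
Qed.

Lemma Rint_sum (I : Type) (s : seq I) (P : pred I) (F : I -> T -> R) :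
  (forall i, P i -> bmeas (F i)) ->
  E (fun x => \sum_(i <- s | P i) F i x) = \sum_(i <- s | P i) E (F i).
Proof.
move=> bF; elim: s => [|i s IHs].
  by rewrite big_nil -[RHS]Rint0; apply: eq_Rint => x; rewrite big_nil.
rewrite big_cons.
case: (boolP (P i)) => Pi; last first.
  by rewrite -IHs; apply: eq_Rint => x; rewrite big_cons (negbTE Pi).
rewrite -IHs -RintD; [|exact: bF|exact: bmeas_sum].
by apply: eq_Rint => x; rewrite big_cons Pi.
Qed.

Lemma Rint_ge0 f : (forall x, 0 <= f x) -> 0 <= E f.
Proof. by move=> f0; exact: Rintegral_ge0. Qed.

Lemma le_Rint f g : bmeas f -> bmeas g -> (forall x, f x <= g x) -> E f <= E g.
Proof. by move=> bf bg fg; apply: le_Rintegral => //; exact: bmeas_integrable. Qed.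

Lemma Rint_norm f : bmeas f -> `|E f| <= E (fun x => `|f x|).
Proof. by move=> bf; apply: le_normr_Rintegral => //; exact: bmeas_integrable. Qed.

Lemma Rint_bound f M : bmeas f -> (forall x, `|f x| <= M) ->
  `|E f| <= M * fine (m setT).
Proof.
move=> bf fM; rewrite (le_trans (Rint_norm bf))// -Rint_cst le_Rint//.
  exact: bmeas_norm.
exact: bmeas_cst.
Qed.

Lemma Rint_indic A : measurable A -> E (\1_A) = fine (m A).
Proof. by move=> mA; rewrite /Rintegral integral_indic// setIT. Qed.

Lemma EFin_Rint f : bmeas f -> (E f)%:E = (\int[m]_x (f x)%:E)%E.
Proof.
by move=> bf; rewrite fineK//; apply: integrable_fin_num => //; exact: bmeas_integrable.
Qed.

(** Dominated convergence with a constant majorant. The exceptional set is an explicit argument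
    because the pointwise ergodic theorem supplies one. *)
Lemma cvg_Rint_ae (f_ : (T -> R)^nat) f M N : measurable N -> m N = 0%E ->
  bmeas f -> (forall n, bmeas (f_ n)) ->
  (forall n x, `|f_ n x| <= M) ->
  (forall x, ~ N x -> f_ n x @[n --> \oo] --> f x) ->
  Rintegral m setT (f_ n) @[n --> \oo] --> Rintegral m setT f.
Proof.
move=> mN N0 bmf bf fM cf.
have [] := @dominated_convergence _ _ _ m setT measurableT
  (fun n => EFin \o f_ n) (EFin \o f) (EFin \o cst M).
- by move=> n; apply/measurable_EFinP; have [] := bf n.
- by apply/measurable_EFinP; case: bmf.
- exists N; split=> // x /= h; apply: contrapT => Nx; apply: h => _.
  by apply: cvg_EFin; [exact: nearW|exact: (cf x Nx)].
- by apply: bmeas_integrable; exact: bmeas_cst.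
- by apply: aeW => x n _ /=; rewrite lee_fin.
move=> _ _ h; apply/(@fine_cvg _ _ _ _ (fun n => (\int[m]_x (f_ n x)%:E)%E)).
by rewrite EFin_Rint.
Qed.

Lemma cvg_Rint (f_ : (T -> R)^nat) f M : (forall n, bmeas (f_ n)) ->
  (forall n x, `|f_ n x| <= M) -> (forall x, f_ n x @[n --> \oo] --> f x) ->
  Rintegral m setT (f_ n) @[n --> \oo] --> Rintegral m setT f.
Proof.
move=> bf fM cf; apply: (@cvg_Rint_ae _ _ M set0) => //.
exact: bmeas_cvg bf fM cf.
Qed.

Lemma Rint_null f A : bmeas f -> measurable A -> m A = 0%E ->
  E (fun x => f x * \1_A x) = 0.
Proof.
move=> bf mA A0; have [M M0 fM] := bmeas_gt0_bound bf.
have b1 : bmeas (fun x => f x * \1_A x) by apply: bmeasM => //; exact: bmeas_indic.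
apply/eqP; rewrite -normr_le0 (le_trans (Rint_norm b1))//.
have -> : 0 = M * E (\1_A) by rewrite Rint_indic// A0 mulr0.
rewrite -RintZ; last exact: bmeas_indic.
apply: le_Rint; [exact: bmeas_norm|by apply: bmeasZ; exact: bmeas_indic|].
by move=> x; rewrite normrM indicE [X in _ * X]ger0_norm// ler_wpM2r.
Qed.

Lemma le_Rint_on (D : set T) f g : measurable D -> m (~` D) = 0%E ->
  bmeas f -> bmeas g -> (forall x, D x -> f x <= g x) -> E f <= E g.
Proof.
move=> mD D0 bf bg fg; have mCD : measurable (~` D) by exact: measurableC.
have split_E h : bmeas h -> E h = E (fun x => h x * \1_D x).
  move=> bh; rewrite -[RHS]addr0 -(Rint_null bh mCD D0) -RintD.
  - apply: eq_Rint => x; rewrite -mulrDr !indicE in_setC.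
    by case: (x \in D); rewrite ?addr0 ?add0r mulr1.
  - by apply: bmeasM => //; exact: bmeas_indic.
  - by apply: bmeasM => //; exact: bmeas_indic.
rewrite (split_E f)// (split_E g)//; apply: le_Rint.
- by apply: bmeasM => //; exact: bmeas_indic.
- by apply: bmeasM => //; exact: bmeas_indic.
move=> x; rewrite indicE; case: (boolP (x \in D)); last by rewrite !mulr0.
by rewrite inE !mulr1 => /fg.
Qed.

End Expectation.

Lemma Rint_pushforward {R : realType} d d' (T : measurableType d)
  (T' : measurableType d') (m : {finite_measure set T -> \bar R})
  (m' : {finite_measure set T' -> \bar R}) (h : T -> T') (f : T' -> R) :
  measurable_fun setT h -> (forall A, measurable A -> m' A = m (h @^-1` A)) ->
  bmeas f -> Rintegral m' setT f = Rintegral m setT (fun x => f (h x)).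
Proof.
move=> mh mm' bf; congr fine.
transitivity (\int[pushforward m h]_x (f x)%:E)%E.
  apply: eq_measure_integral => A mA _; exact: mm'.
rewrite integral_pushforward//.
- by apply/measurable_EFinP; case: bf.
- rewrite preimage_setT.
  by apply: (@bmeas_integrable _ _ _ m (f \o h)); exact: bmeas_comp.
Qed.

Lemma product_measureT_fin_num {R : realType} d d' (T : measurableType d)
    (T' : measurableType d') (m1 : {finite_measure set T -> \bar R})
    (m2 : {finite_measure set T' -> \bar R}) :
  (m1 \x m2)%E setT \is a fin_num.
Proof.
have -> : (m1 \x m2)%E setT = (m1 setT * m2 setT)%E.
  by rewrite -setXTT product_measure1E.
by rewrite fin_numM// fin_num_measure.
Qed.

Lemma Rint_product {R : realType} d d' (T : measurableType d)
    (T' : measurableType d') (m1 : {finite_measure set T -> \bar R})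
    (m2 : {finite_measure set T' -> \bar R}) (f : T -> R) (g : T' -> R) :
  bmeas f -> bmeas g ->
  Rintegral (m1 \x m2)%E setT (fun p => f p.1 * g p.2) =
  Rintegral m1 setT f * Rintegral m2 setT g.
Proof.
move=> bf bg.
have bfg : bmeas (fun p : T * T' => f p.1 * g p.2).
  by apply: bmeasM; apply: bmeas_comp.
have ifg : (m1 \x m2)%E.-integrable setT
    (EFin \o (fun p : T * T' => f p.1 * g p.2)).
  have [mfg [M fgM]] := bfg.
  apply: measurable_bounded_integrable => //.
    by rewrite ltey_eq product_measureT_fin_num.
  exists M; split; first by rewrite num_real.
  by move=> N MN x _; exact: le_trans (fgM x) (ltW MN).
rewrite {1}/Rintegral -integral12_prod_meas1//= /fubini_F/=.
transitivity (Rintegral m1 setT (fun x => f x * Rintegral m2 setT g)).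
  congr (fine (integral _ _ _)); apply/funext => x /=.
  rewrite [RHS]EFinM EFin_Rint// -integralZl//; last exact: bmeas_integrable.
under eq_Rint do rewrite mulrC.
by rewrite RintZ// mulrC.
Qed.

(** * Complex integrals and Fubini for finite products *)

Section ComplexIntegral.
Context {R : realType}.
Local Notation C := R[i].
Local Notation Re := complex.Re.
Local Notation Im := complex.Im.

Definition cbmeas d (T : measurableType d) (h : T -> C) :=
  bmeas (fun x => Re (h x)) /\ bmeas (fun x => Im (h x)).

Lemma ReM (z w : C) : Re (z * w) = Re z * Re w - Im z * Im w.
Proof. by case: z w => [a b] [c d]. Qed.

Lemma ImM (z w : C) : Im (z * w) = Re z * Im w + Im z * Re w.
Proof. by case: z w => [a b] [c d]. Qed.

Lemma cbmeas_cst d (T : measurableType d) c : cbmeas (fun _ : T => c).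
Proof. by split; exact: bmeas_cst. Qed.

Lemma cbmeasM d (T : measurableType d) (f g : T -> C) :
  cbmeas f -> cbmeas g -> cbmeas (fun x => f x * g x).
Proof.
move=> [bf bf'] [bg bg']; split.
  by under eq_fun do rewrite ReM; apply: bmeasB; apply: bmeasM.
by under eq_fun do rewrite ImM; apply: bmeasD; apply: bmeasM.
Qed.

Lemma cbmeas_comp d d' (T : measurableType d) (T' : measurableType d')
    (f : T -> C) (h : T' -> T) :
  cbmeas f -> measurable_fun setT h -> cbmeas (fun x => f (h x)).
Proof.
by move=> [bf bf'] mh; split;
  [exact: (bmeas_comp bf mh)|exact: (bmeas_comp bf' mh)].
Qed.

Lemma cbmeas_prod d (T : measurableType d) (I : Type) (s : seq I)
    (P : pred I) (F : I -> T -> C) :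
  (forall i, P i -> cbmeas (F i)) ->
  cbmeas (fun x => \prod_(i <- s | P i) F i x).
Proof.
move=> bF; elim: s => [|i s IHs].
  by under eq_fun do rewrite big_nil; exact: cbmeas_cst.
under eq_fun do rewrite big_cons.
case: (boolP (P i)) => Pi; last exact: IHs.
by apply: cbmeasM => //; exact: bF.
Qed.

Lemma cbmeas_real d (T : measurableType d) (f : T -> R) :
  bmeas f -> cbmeas (fun x => (f x)%:C%C).
Proof. by move=> bf; split => //; exact: bmeas_cst. Qed.

Lemma cint_real d (T : measurableType d)
  (m : {finite_measure set T -> \bar R}) (f : T -> R) :
  cintegral m (fun x => (f x)%:C%C) = (Rintegral m setT f)%:C%C.
Proof. by rewrite /cintegral; congr Complex; exact: Rint0. Qed.

Lemma cint_pushforward d d' (T : measurableType d)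
  (T' : measurableType d') (m : {finite_measure set T -> \bar R})
  (m' : {finite_measure set T' -> \bar R}) (h : T -> T') (f : T' -> C) :
  measurable_fun setT h -> (forall A, measurable A -> m' A = m (h @^-1` A)) ->
  cbmeas f -> cintegral m' f = cintegral m (fun x => f (h x)).
Proof.
by move=> mh mm' [bf bf']; congr Complex; exact: (Rint_pushforward mh).
Qed.

Lemma cint_product d d' (T : measurableType d)
    (T' : measurableType d') (m1 : {finite_measure set T -> \bar R})
    (m2 : {finite_measure set T' -> \bar R}) (f : T -> C) (g : T' -> C)
    (m : {finite_measure set (T * T')%type -> \bar R}) :
  (forall A, measurable A -> m A = (m1 \x m2)%E A) ->
  cbmeas f -> cbmeas g ->
  cintegral m (fun p => f p.1 * g p.2) = cintegral m1 f * cintegral m2 g.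
Proof.
move=> mE [bf bf'] [bg bg'].
have bfst (h : T -> R) : bmeas h -> bmeas (fun p : T * T' => h p.1).
  by move=> bh; apply: bmeas_comp => //; exact: measurable_fst.
have bsnd (h : T' -> R) : bmeas h -> bmeas (fun p : T * T' => h p.2).
  by move=> bh; apply: bmeas_comp => //; exact: measurable_snd.
have Em (h : T * T' -> R) :
    Rintegral m setT h = Rintegral (m1 \x m2)%E setT h.
  by congr fine; apply: eq_measure_integral => A mA _; exact: mE.
rewrite /cintegral; congr Complex.
  rewrite (eq_Rint m (fun x => ReM _ _)).
  rewrite RintB; last 2 first.
    by apply: bmeasM; [exact: (bfst _ bf)|exact: (bsnd _ bg)].
    by apply: bmeasM; [exact: (bfst _ bf')|exact: (bsnd _ bg')].
  rewrite !Em.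
  rewrite (Rint_product m1 m2 bf bg).
  by rewrite (Rint_product m1 m2 bf' bg').
rewrite (eq_Rint m (fun x => ImM _ _)).
rewrite RintD; last 2 first.
  by apply: bmeasM; [exact: (bfst _ bf)|exact: (bsnd _ bg')].
  by apply: bmeasM; [exact: (bfst _ bf')|exact: (bsnd _ bg)].
rewrite !Em.
rewrite (Rint_product m1 m2 bf bg').
by rewrite (Rint_product m1 m2 bf' bg).
Qed.

Lemma cbmeas_coord (I : finType) (d : I -> measure_display)
    (Y : forall i, measurableType (d i)) i (f : Y i -> C) :
  cbmeas f -> cbmeas (fun y : dprod Y => f (y i)).
Proof. by move=> bf; apply: cbmeas_comp => //; exact: measurable_coord. Qed.

(** Fubini along the construction of [prodm]: [resample] is the image of a binary product under
    [set_coord i], and since [i] does not recur in the enumeration, the other factors do not see the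
    coordinate just resampled. At the end of the enumeration only the total mass 1 of the Dirac
    measure is left. *)
Lemma cint_prodm (I : finType) (d : I -> measure_display)
    (Y : forall i, measurableType (d i))
    (nu : forall i, {finite_measure set (Y i) -> \bar R})
    (f : forall i, Y i -> C) :
  (forall i, cbmeas (f i)) ->
  cintegral (prodm nu) (fun y => \prod_i f i (y i)) =
  \prod_i cintegral (nu i) (f i).
Proof.
move=> bf.
have bF s : cbmeas (fun y : dprod Y => \prod_(i <- s) f i (y i)).
  by apply: cbmeas_prod => i _; exact: cbmeas_coord.
rewrite -[RHS]big_enum/=.
transitivity (cintegral (prodm nu) (fun y => \prod_(i <- enum I) f i (y i))).
  by congr cintegral; apply/funext => y; rewrite big_enum.
have := enum_uniq I; rewrite /prodm.
elim: (enum I) => [_|i s IHs /= /andP[si us]].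
  rewrite big_nil /=.
  transitivity (cintegral (dirac (point : dprod Y) : {finite_measure set _ -> \bar R})
      (fun _ => (1 : R)%:C%C)).
    by congr cintegral; apply/funext => y; rewrite big_nil.
  rewrite cint_real Rint_cst mul1r.
  exact: (congr1 (fun x => (fine x)%:C%C) (diracT R (point : dprod Y))).
rewrite big_cons -IHs//; set m := foldr _ _ _.
transitivity (cintegral (resample (nu i) m)
    (fun y : dprod Y => f i (y i) * \prod_(j <- s) f j (y j))).
  by congr cintegral; apply/funext => y; rewrite big_cons.
pose g (y : dprod Y) := \prod_(j <- s) f j (y j).
have gE p : g (@set_coord _ _ Y i p) = g p.2.
  apply: eq_big_seq => j js; rewrite /set_coord dfwithout//.
  by apply: contra si => /eqP ->.
have mfin : fin_num_fun (nu i \x m)%E.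
  apply: lty_fin_num_fun.
  by rewrite ltey_eq product_measureT_fin_num.
pose fm := Measure_isFinite.Build _ _ _ (nu i \x m)%E mfin.
pose m' : {finite_measure set _ -> \bar R} := HB.pack ((nu i \x m)%E) fm.
have bF1 : cbmeas (fun y : dprod Y => f i (y i) * \prod_(j <- s) f j (y j)).
  by apply: cbmeasM => //; exact: cbmeas_coord.
rewrite [LHS](@cint_pushforward _ _ _ _ m' _ (@set_coord _ _ Y i))//.
- rewrite -(@cint_product _ _ _ _ _ _ _ _ m')//.
  congr cintegral; apply/funext => p; congr (_ * _); last exact: gE.
  by rewrite /set_coord dfwithin.
- exact: measurable_set_coord.
Qed.

Lemma Rint_prodm (I : finType) (d : I -> measure_display)
    (Y : forall i, measurableType (d i))
    (nu : forall i, {finite_measure set (Y i) -> \bar R})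
    (f : forall i, Y i -> R) :
  (forall i, bmeas (f i)) ->
  Rintegral (prodm nu) setT (fun y => \prod_i f i (y i)) =
  \prod_i Rintegral (nu i) setT (f i).
Proof.
move=> bf; apply: (@complexI R); rewrite -cint_real rmorph_prod/=.
transitivity (cintegral (prodm nu) (fun y => \prod_i (f i (y i))%:C%C)).
  by congr cintegral; apply/funext => y; rewrite rmorph_prod.
rewrite (@cint_prodm _ _ Y nu (fun i y => (f i y)%:C%C)).
  by apply: eq_bigr => i _; rewrite cint_real.
by move=> i; exact: cbmeas_real.
Qed.

End ComplexIntegral.

(** * The mean ergodic theorem *)

Definition cesaro {R : realType} (u : nat -> R) (n : nat) : R :=
  n.+1%:R^-1 * \sum_(k < n.+1) u k.

Section Ergodic.
Context {R : realType} {d} {T : measurableType d}.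
Variables (m : probability T R) (W : T -> T).
Hypothesis mW : measurable_fun setT W.
Hypothesis preserving : forall A, measurable A -> m (W @^-1` A) = m A.
Hypothesis erg : ergodic m W.
Implicit Types F G : T -> R.
Local Notation E f := (Rintegral m setT f).

Lemma measurable_iter k : measurable_fun setT (iter k W).
Proof.
elim: k => [|k IHk] /=; first exact: measurable_id.
exact: measurableT_comp.
Qed.

Lemma Rint_invariant F : bmeas F -> E (fun x => F (W x)) = E F.
Proof.
by move=> bF; apply/esym/Rint_pushforward => // A mA; exact/esym/preserving.
Qed.

(* The maximum of the ergodic sums of [F] of length at most [n] at [x]; this form
   of the recursion gives the maximal inequality at once. *)
Fixpoint maxsum F n x : R :=
  if n is n'.+1 then Num.max 0 (F x + maxsum F n' (W x)) else 0.

Lemma maxsum_ge0 F n x : 0 <= maxsum F n x.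
Proof. by case: n => //= n; rewrite le_max lexx. Qed.

Lemma bmeas_maxsum F n : bmeas F -> bmeas (maxsum F n).
Proof.
move=> bF; elim: n => [|n IHn] /=; first exact: bmeas_cst.
have [mS [M SM]] : bmeas (fun x => F x + maxsum F n (W x)).
  by apply: bmeasD => //; exact: (bmeas_comp IHn mW).
split; first exact: measurable_maxr.
exists M => x; rewrite ger0_norm ?le_max ?lexx// ge_max.
by rewrite (le_trans _ (SM x))//= (le_trans (ler_norm _) (SM x)).
Qed.

Lemma maxsum_homo F n x : maxsum F n x <= maxsum F n.+1 x.
Proof.
elim: n x => [|n IHn] x; first exact: (maxsum_ge0 F 1).
by rewrite [leLHS]/= [leRHS]/= ge_max !le_max lexx/= lerD2l IHn orbT.
Qed.

Lemma maxsum_ge_sum F n x : \sum_(k < n) F (iter k W x) <= maxsum F n x.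
Proof.
elim: n x => [|n IHn] x; first by rewrite big_ord0.
rewrite big_ord_recl/= le_max lerD2l; apply/orP; right.
apply: le_trans (IHn _); apply: ler_sum => i _.
by rewrite /bump/= -iterSr.
Qed.

Lemma measurable_maxsum_gt0 F n : bmeas F -> measurable [set x | 0 < maxsum F n x].
Proof.
move=> /(bmeas_maxsum n) [mM _].
rewrite -[X in measurable X]setTI.
rewrite (_ : [set x | 0 < maxsum F n x] = maxsum F n @^-1` `]0, +oo[%classic).
  exact: mM.
by apply/seteqP; split => x; rewrite /= in_itv/= andbT.
Qed.

(** Garsia's argument. Where [maxsum F n.+1] is positive it equals [F x + maxsum F n (W x)], and
    elsewhere it vanishes; so [maxsum F n.+1 x - maxsum F n (W x)] is at most the integrand, and it
    has nonnegative integral because [W] preserves [m] and [maxsum] grows with [n]. *)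
Lemma maximal_ergodic F n : bmeas F ->
  0 <= E (fun x => F x * \1_[set x | 0 < maxsum F n x] x).
Proof.
move=> bF; case: n => [|n].
  rewrite (eq_Rint m (g := fun=> 0)) ?Rint0// => x.
  by rewrite indicE memNset ?mulr0//= ltxx.
have bM k := bmeas_maxsum k bF.
have : 0 <= E (fun x => maxsum F n.+1 x - maxsum F n (W x)).
  rewrite RintB//; last exact: (bmeas_comp (bM n) mW).
  rewrite Rint_invariant// subr_ge0 le_Rint// => x; exact: maxsum_homo.
move=> /le_trans; apply; apply: le_Rint.
- by apply: bmeasB => //; exact: (bmeas_comp (bM n) mW).
- by apply: bmeasM => //; apply: bmeas_indic; exact: measurable_maxsum_gt0.
move=> x; rewrite indicE.
case: (boolP (_ \in _)) => [|]; rewrite ?(inE, notin_setE) => Mx.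
  rewrite mulr1 lerBlDr; move: Mx => /=; case: (lerP 0 (F x + _)) => //=.
  by rewrite ltxx.
rewrite mulr0 subr_le0.
apply: (@le_trans _ _ 0); last exact: maxsum_ge0.
by rewrite leNgt; apply/negP.
Qed.

(* Unlike the set where the averages have a positive upper limit, this set is
   strictly invariant for trivial reasons. *)
Definition unbounded_sums F : set T :=
  \bigcap_(K in setT) \bigcup_(n in setT)
    [set x | K%:R < \sum_(k < n) F (iter k W x)].

Lemma bmeas_iter F k : bmeas F -> bmeas (fun x => F (iter k W x)).
Proof. by move=> bF; apply: bmeas_comp => //; exact: measurable_iter. Qed.

Lemma measurable_unbounded_sums F : bmeas F -> measurable (unbounded_sums F).
Proof.
move=> bF; apply: bigcapT_measurable => K; apply: bigcupT_measurable => n.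
have [mS _] : bmeas (fun x => \sum_(k < n) F (iter k W x)).
  by apply: bmeas_sum => i _; exact: bmeas_iter.
rewrite -[X in measurable X]setTI.
have := mS measurableT `]K%:R, +oo[%classic (measurable_itv _).
congr measurable; apply/seteqP; split => x /=; rewrite in_itv/= andbT; tauto.
Qed.

Lemma unbounded_sums_invariant F : bmeas F ->
  W @^-1` unbounded_sums F = unbounded_sums F.
Proof.
move=> /bmeas_gt0_bound[M M0 FM].
have sumS n x : \sum_(k < n.+1) F (iter k W x) =
    F x + \sum_(k < n) F (iter k W (W x)).
  by rewrite big_ord_recl/=; congr (_ + _); apply: eq_bigr => i _; rewrite /bump/= -iterSr.
apply/seteqP; split=> x /= ux K _.
  (* The sums at [x] and at [W x] differ by the single term [F x], at most [M] in absolute value;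
     asking for a threshold higher by [M] rounded up pays for it. *)
  have [n _ /= h] := ux (K + `|Num.ceil M|)%N I; exists n.+1 => //=.
  rewrite sumS; have := FM x; rewrite ler_norml => /andP[FMx _].
  have : M <= `|Num.ceil M|%:R.
    by rewrite natr_absz (le_trans (ceil_ge _))// ler_int ler_norm.
  rewrite natrD in h; lra.
have [[|n] _ /= h] := ux (K + `|Num.ceil M|)%N I.
  by move: h; rewrite big_ord0 ltNge ler0n.
exists n => //=.
have := FM x; rewrite ler_norml => /andP[_ FMx].
have : M <= `|Num.ceil M|%:R.
  by rewrite natr_absz (le_trans (ceil_ge _))// ler_int ler_norm.
rewrite sumS natrD in h; lra.
Qed.

(** Otherwise, by ergodicity, the set has full measure. At each of its points some sum is positive,
    so [maxsum F n] is positive from some [n] on, and the maximal inequality becomes [0 <= E F] in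
    the limit. *)
Lemma unbounded_sums_null F : bmeas F -> E F < 0 -> m (unbounded_sums F) = 0%E.
Proof.
move=> bF F0.
have [//|h] := erg (measurable_unbounded_sums bF) (unbounded_sums_invariant bF).
exfalso; have [M M0 FM] := bmeas_gt0_bound bF.
suff : E (fun x => F x * \1_[set x | 0 < maxsum F n x] x) @[n --> \oo] --> E F.
  move=> cv; have : 0 <= E F.
    rewrite -(cvg_lim _ cv)//; apply: limr_ge.
      by apply/cvg_ex; exists (E F).
    by apply: nearW => n; exact: maximal_ergodic.
  by rewrite leNgt F0.
apply: (@cvg_Rint_ae _ _ _ m _ _ M (~` unbounded_sums F)) => //.
- by apply: measurableC; exact: measurable_unbounded_sums.
- by move=> n; apply: bmeasM => //; apply: bmeas_indic; exact: measurable_maxsum_gt0.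
- move=> n x; rewrite normrM indicE.
  by case: (_ \in _); rewrite ?normr1 ?mulr1// normr0 mulr0 ltW.
move=> x /contrapT ux; have [n _ /= Sn] := ux 0%N I.
apply: cvg_near_cst; near=> k; rewrite indicE mem_set ?mulr1//=.
have : (n <= k)%N by near: k; exact: nbhs_infty_ge.
move=> /subnKC <-; elim: (k - n)%N => [|l IHl].
  by rewrite addn0 (lt_le_trans _ (maxsum_ge_sum _ _ _))// (le_lt_trans _ Sn).
by rewrite addnS (lt_le_trans IHl)// maxsum_homo.
Unshelve. all: by end_near. Qed.

Lemma cesaro_bound (u : nat -> R) M n : (forall k, `|u k| <= M) -> `|cesaro u n| <= M.
Proof.
move=> uM; rewrite /cesaro normrM gtr0_norm ?invr_gt0// ler_pdivrMl//.
rewrite (le_trans (ler_norm_sum _ _ _))//.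
rewrite (le_trans (ler_sum _ (fun i _ => uM _)))//.
by rewrite sumr_const card_ord mulr_natl.
Qed.

(** [F - e] and [- F - e] have negative mean, so almost everywhere their sums are bounded above, by
    some [K1] and [K2]. Hence the averages of [F] are at most [e + (|K1| + |K2|) / n.+1] in absolute
    value; taking [e = 1 / j.+1] keeps the exceptional set a countable union. *)
Lemma birkhoff F : bmeas F -> E F = 0 -> exists N, [/\ measurable N, m N = 0%E &
  forall x, ~ N x -> cesaro (fun k => F (iter k W x)) n @[n --> \oo] --> 0].
Proof.
move=> bF F0.
pose e j : R := j.+1%:R^-1.
pose F1 j x := F x - e j; pose F2 j x := - F x - e j.
have b1 j : bmeas (F1 j) by apply: bmeasB => //; exact: bmeas_cst.
have b2 j : bmeas (F2 j) by apply: bmeasB; [exact: bmeasN|exact: bmeas_cst].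
have mT : fine (m setT) = 1 by rewrite probability_setT.
have e0 j : 0 < e j by rewrite invr_gt0.
have E1 j : E (F1 j) < 0.
  by rewrite RintB//; [rewrite F0 Rint_cst mT mulr1 sub0r oppr_lt0|exact: bmeas_cst].
have E2 j : E (F2 j) < 0.
  rewrite RintB//; [|exact: bmeasN|exact: bmeas_cst].
  by rewrite RintN// F0 Rint_cst mT mulr1 oppr0 sub0r oppr_lt0.
pose N := \bigcup_j (unbounded_sums (F1 j) `|` unbounded_sums (F2 j)).
have mN j : measurable (unbounded_sums (F1 j) `|` unbounded_sums (F2 j)).
  by apply: measurableU; exact: measurable_unbounded_sums.
exists N; split.
- exact: bigcupT_measurable.
- apply/negligibleP; first exact: bigcupT_measurable.
  apply: negligible_bigcup => j; apply: negligibleU; apply/negligibleP;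
    by [exact: measurable_unbounded_sums|exact: unbounded_sums_null].
move=> x Nx.
have bdd G : ~ unbounded_sums G x ->
    exists K, forall n, \sum_(k < n) G (iter k W x) <= K.
  move=> h; apply: contrapT => h'; apply: h => K _; apply: contrapT => h''.
  apply: h'; exists K%:R => n; rewrite leNgt; apply/negP => nK.
  by apply: h''; exists n.
apply/cvgrPdist_le => eps eps0.
have [j je] : exists j, e j <= eps / 2.
  have := @near_infty_natSinv_lt R (PosNum (divr_gt0 eps0 (@ltr0Sn R 1))).
  by move=> [j _ /(_ j (leqnn _)) /= /ltW]; exists j.
have [K1 h1] : exists K, forall n, \sum_(k < n) F1 j (iter k W x) <= K.
  by apply: bdd => h; apply: Nx; exists j => //; left.
have [K2 h2] : exists K, forall n, \sum_(k < n) F2 j (iter k W x) <= K.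
  by apply: bdd => h; apply: Nx; exists j => //; right.
have /cvgrPdist_le/(_ _ (divr_gt0 eps0 (@ltr0Sn R 1))) :
    (`|K1| + `|K2|) * n.+1%:R^-1 @[n --> \oo] --> (0 : R).
  rewrite -[X in _ --> X](mulr0 (`|K1| + `|K2|)); apply: cvgM; first exact: cvg_cst.
  exact: cvg_harmonic.
apply: filterS => n; rewrite !sub0r !normrN ger0_norm; last first.
  by rewrite mulr_ge0// ?addr_ge0// invr_ge0.
move=> Kn.
have {}h1 := h1 n.+1; have {}h2 := h2 n.+1.
rewrite sumrB sumr_const card_ord in h1.
rewrite sumrB sumrN sumr_const card_ord in h2.
rewrite /cesaro normrM gtr0_norm ?invr_gt0// mulrC ler_pdivrMr//.
rewrite ler_pdivrMr// in Kn.
have n0 : 0 < n.+1%:R :> R by [].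
have jn : e j *+ n.+1 <= eps / 2 * n.+1%:R by rewrite mulr_natr lerMn2r je orbT.
have := ler_norm K1; have := ler_norm K2; have := normr_ge0 K1.
have := normr_ge0 K2.
set S := \sum_(_ < _) _ in h1 h2 *.
move=> *; rewrite ler_norml; apply/andP; split; lra.
Qed.

Lemma mean_ergodic F G : bmeas F -> bmeas G ->
  cesaro (fun k => E (fun x => F (iter k W x) * G x)) n @[n --> \oo] --> E F * E G.
Proof.
move=> bF bG.
have mT : fine (m setT) = 1 by rewrite probability_setT.
pose F0 x := F x - E F.
have bF0 : bmeas F0 by apply: bmeasB => //; exact: bmeas_cst.
have [|N [mN N0 cN]] := birkhoff bF0.
  by rewrite RintB//; [rewrite Rint_cst mT mulr1 subrr|exact: bmeas_cst].
have [M M0 FM] := bmeas_gt0_bound bF0.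
have [M' M'0 GM] := bmeas_gt0_bound bG.
pose h n x := cesaro (fun k => F0 (iter k W x)) n * G x.
have bh n : bmeas (h n).
  apply: bmeasM => //; rewrite /cesaro; apply: bmeasZ.
  by apply: bmeas_sum => i _; exact: bmeas_iter.
have : E (h n) @[n --> \oo] --> E (fun=> 0).
  apply: (@cvg_Rint_ae _ _ _ m _ _ (M * M') N) => //.
  - exact: bmeas_cst.
  - by move=> n x; rewrite normrM ler_pM//; exact: cesaro_bound.
  - move=> x Nx; rewrite -[X in _ --> X](mul0r (G x)).
    by apply: cvgM; [exact: cN|exact: cvg_cst].
rewrite Rint0 => ch.
rewrite -[X in _ --> X]add0r.
under eq_fun => n.
  rewrite (_ : cesaro _ n = E (h n) + E F * E G); first over.
  rewrite {1}/cesaro.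
  have bs k : bmeas (fun x => F0 (iter k W x) * G x).
    by apply: bmeasM => //; exact: bmeas_iter.
  transitivity (n.+1%:R^-1 * \sum_(k < n.+1)
      (E (fun x => F0 (iter k W x) * G x) + E F * E G)).
    congr (_ * _); apply: eq_bigr => k _; rewrite -RintZ// -RintD//; last exact: bmeasZ.
    by apply: eq_Rint => x; rewrite /F0 mulrBl subrK.
  rewrite big_split/= mulrDr sumr_const card_ord -[X in _ + _ * X]mulr_natl mulKf//.
  congr (_ + _); rewrite -Rint_sum// -RintZ; last by apply: bmeas_sum.
  by apply: eq_Rint => x; rewrite /h /cesaro -mulrA mulr_suml.
by apply: cvgD => //; exact: cvg_cst.
Qed.

End Ergodic.

(** * Spectral measures of stationary sequences *)

Section PlaneOpen.
Context {R : realType} {d} {T : measurableType d}.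

(** An open set of the plane is the countable union of the rational boxes it contains. The
    sigma-algebra of the domain is arbitrary: it will also be one that is not yet known to contain
    the Borel sets of the circle. *)
Lemma measurable_preimage_open2 (f g : T -> R) (U : set (R * R)) :
  measurable_fun setT f -> measurable_fun setT g -> open U ->
  measurable [set x | U (f x, g x)].
Proof.
move=> mf mg oU.
pose box (a b c e : rat) := [set p : R * R |
  [/\ ratr a < p.1, p.1 < ratr b, ratr c < p.2 & p.2 < ratr e]].
pose F a b c e := [set x | box a b c e `<=` U /\ box a b c e (f x, g x)].
rewrite (_ : [set x | _] =
    \bigcup_a \bigcup_b \bigcup_c \bigcup_e F a b c e); last first.
  apply/seteqP; split => [x /= Ux|x [a _ [b _ [c _ [e _ [abU h]]]]]]; last exact: abU.
  have [eps /= eps0 epsU] : exists2 e : R, 0 < e & forall p : R * R,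
      `|f x - p.1| < e -> `|g x - p.2| < e -> U p.
    have /nbhs_ballP[e /= e0 eU] := open_nbhs_nbhs (conj oU Ux).
    by exists e => // p p1 p2; apply: eU; split.
  have ltB : f x - eps < f x by rewrite ltrBlDr ltrDl.
  have ltD : f x < f x + eps by rewrite ltrDl.
  have ltB' : g x - eps < g x by rewrite ltrBlDr ltrDl.
  have ltD' : g x < g x + eps by rewrite ltrDl.
  have [a] := rat_in_itvoo ltB; have [b] := rat_in_itvoo ltD.
  have [c] := rat_in_itvoo ltB'; have [e] := rat_in_itvoo ltD'.
  rewrite !in_itv/= => /andP[e1 e2] /andP[c1 c2] /andP[b1 b2] /andP[a1 a2].
  exists a => //; exists b => //; exists c => //; exists e => //; split=> //.
  move=> [u v] [/= u1 u2 v1 v2]; apply: epsU => /=; rewrite ltr_norml; lra.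
apply: bigcupT_measurable_rat => a; apply: bigcupT_measurable_rat => b.
apply: bigcupT_measurable_rat => c; apply: bigcupT_measurable_rat => e.
case: (pselect (box a b c e `<=` U)) => [sU|nsU]; last first.
  rewrite (_ : F _ _ _ _ = set0); first exact: measurable0.
  by apply/seteqP; split=> x // [].
rewrite (_ : F _ _ _ _ = (f @^-1` `]ratr a, ratr b[) `&` (g @^-1` `]ratr c, ratr e[)).
  apply: measurableI; rewrite -[X in measurable X]setTI.
    exact: (mf measurableT _ (measurable_itv _)).
  exact: (mg measurableT _ (measurable_itv _)).
apply/seteqP; split=> x /=; rewrite !in_itv/=.
  by move=> [_ [/= -> -> -> ->]].
by move=> [/andP[? ?] /andP[? ?]]; split.
Qed.

End PlaneOpen.

(** * The circle and its characters *)

Section CircleBasics.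
Context {R : realType}.
Local Notation C := R[i].
Local Notation Re := complex.Re.
Local Notation Im := complex.Im.
Local Notation circleB := (circleB R).

Lemma measurable_to_circle d (T : measurableType d) (f : T -> circleB) :
  measurable_fun setT (fun x => Re (val (f x))) ->
  measurable_fun setT (fun x => Im (val (f x))) -> measurable_fun setT f.
Proof.
move=> mf mg; apply: (@measurability _ _ _ _ setT f (@circle_open R)) => //.
move=> _ [_ [U oU <-] <-]; rewrite setTI.
exact: (measurable_preimage_open2 mf mg).
Qed.

Lemma measurable_circle_continuous (p : R * R -> R) : continuous p ->
  measurable_fun setT (fun z : circleB => p (Re (val z), Im (val z))).
Proof.
move=> cp; apply: (measurability _ (RGenOInfty.measurableE R)) => //.
move=> _ [_ [a ->] <-]; rewrite setTI; apply: sub_sigma_algebra.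
exists (p @^-1` `]a, +oo[%classic) => //.
by move/continuousP : cp; apply; exact: interval_open.
Qed.

Lemma circle_Re_Im (z : circleB) : Re (val z) ^+ 2 + Im (val z) ^+ 2 = 1.
Proof.
have := eqP (valP z); rewrite -[X in X = _]RRe_real ?normr_real//.
move=> /(congr1 (fun x => x ^+ 2)); rewrite RRe_real ?normr_real//.
by rewrite -add_Re2_Im2 expr1n => -[].
Qed.

Lemma bmeas_circle_Re : bmeas (fun z : circleB => Re (val z)).
Proof.
split; first by apply: (@measurable_circle_continuous fst) => x; exact: cvg_fst.
exists 1 => z; rewrite -(@ler_pXn2r _ 2)// ?nnegrE// real_normK ?num_real// expr1n.
by rewrite -(circle_Re_Im z) lerDl sqr_ge0.
Qed.

Lemma bmeas_circle_Im : bmeas (fun z : circleB => Im (val z)).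
Proof.
split; first by apply: (@measurable_circle_continuous snd) => x; exact: cvg_snd.
exists 1 => z; rewrite -(@ler_pXn2r _ 2)// ?nnegrE// real_normK ?num_real// expr1n.
by rewrite -(circle_Re_Im z) lerDr sqr_ge0.
Qed.

Lemma circle_valV (z : circleB) : (val z)^-1 = conjc (val z).
Proof. by rewrite invc_norm (eqP (valP z)) expr1n invr1 mul1r. Qed.

Lemma cbmeas_circle_expr (k : nat) : cbmeas (fun z : circleB => val z ^+ k).
Proof.
elim: k => [|k IHk]; first exact: cbmeas_cst.
under eq_fun do rewrite exprS.
apply: cbmeasM IHk; split; [exact: bmeas_circle_Re|exact: bmeas_circle_Im].
Qed.

Lemma cbmeas_conj d (T : measurableType d) (f : T -> C) :
  cbmeas f -> cbmeas (fun x => conjc (f x)).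
Proof.
move=> [bf bf']; split.
  by have -> : (fun x => Re (conjc (f x))) = (fun x => Re (f x))
    by apply/funext => x; case: (f x).
have -> : (fun x => Im (conjc (f x))) = (fun x => - Im (f x))
  by apply/funext => x; case: (f x).
exact: bmeasN.
Qed.

Lemma cbmeas_circle_exprz (k : int) : cbmeas (fun z : circleB => val z ^ k).
Proof.
case: k => k; first exact: cbmeas_circle_expr.
rewrite (_ : (fun z => _) = (fun z : circleB => conjc (val z ^+ k.+1))).
  by apply: cbmeas_conj; exact: cbmeas_circle_expr.
by apply/funext => z; rewrite NegzE -exprz_inv circle_valV -exprnP rmorphXn.
Qed.

Lemma expi_subproof (t : R) : `|Complex (cos t) (sin t)| == 1.
Proof. by rewrite normc_def/= cos2Dsin2 sqrtr1. Qed.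

Definition expi (t : R) : circleB := exist _ (Complex (cos t) (sin t)) (expi_subproof t).

Lemma expiD s t : val (expi (s + t)) = val (expi s) * val (expi t).
Proof.
rewrite /= cosD sinD; apply/eqP; rewrite eq_complex/=.
by rewrite eqxx/= addrC [cos s * _]mulrC [sin s * _]mulrC; apply/eqP; ring.
Qed.

Lemma expi_exprz t (k : int) : val (expi t) ^ k = val (expi (k%:~R * t)).
Proof.
have En n u : val (expi u) ^+ n = val (expi (n%:R * u)).
  elim: n => [|n IHn]; last by rewrite exprS IHn -expiD -natr1 mulrDl mul1r addrC.
  by rewrite mul0r expr0; apply/eqP; rewrite eq_complex/= cos0 sin0 !eqxx.
case: k => n; first exact: En.
rewrite NegzE -exprz_inv -exprnP circle_valV.
have -> : conjc (val (expi t)) = val (expi (- t)) by rewrite /= cosN sinN.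
by rewrite En intrN mulNr mulrN.
Qed.

Lemma measurable_expi : measurable_fun setT expi.
Proof.
by apply: measurable_to_circle => /=; apply: continuous_measurable_fun;
  [exact: continuous_cos|exact: continuous_sin].
Qed.

End CircleBasics.

(** * Step functions, Riemann sums and quantile functions *)

Section Partition.
Context {R : realType}.
Variable p : nat -> R.
Hypothesis p_homo : {homo p : i j / (i <= j)%N >-> i <= j}.

Lemma partition_find n s : p 0 <= s < p n ->
  exists2 j, (j < n)%N & p j <= s < p j.+1.
Proof.
elim: n => [|n IHn] /andP[s0 sn]; first by move: (le_lt_trans s0 sn); rewrite ltxx.
have [sp|ps] := ltP s (p n); last by exists n => //; rewrite ps.
by have [|j jn js] := IHn; [rewrite s0|exists j => //; rewrite ltnS ltnW].
Qed.

Lemma step_sum n j s (c : nat -> R) : (j < n)%N -> p j <= s < p j.+1 ->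
  \sum_(i < n) c i * \1_(`[p i, p i.+1[%classic) s = c j.
Proof.
move=> jn /andP[js sj]; rewrite (bigD1 (Ordinal jn))//= big1 => [|i ij].
  by rewrite addr0 indicE mem_set ?mulr1//= in_itv/= js.
rewrite indicE memNset ?mulr0//= in_itv/= => /andP[is_ si].
have : (i < j)%N || (j < i)%N.
  by rewrite -neq_ltn; apply: contra ij => /eqP ij; apply/eqP/val_inj.
by case/orP => /p_homo; rewrite leNgt => /negP; apply;
  [exact: le_lt_trans js si|exact: le_lt_trans is_ sj].
Qed.

End Partition.

Section Quantile.
Context {R : realType}.
Variable c : R.
Hypothesis c0 : 0 <= c.

Let mD : measurable (`[0, c[%classic : set (measurableTypeR R)).
Proof. exact: measurable_itv. Qed.

Let Doo : (lebesgue_measure (`[0%R, c[%classic : set R) < +oo)%E.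
Proof. by rewrite lebesgue_measure_itv/=; case: ifP => _; rewrite ltry. Qed.

Definition leb_itv : {finite_measure set (measurableTypeR R) -> \bar R} :=
  mfrestr mD Doo.
Local Notation E f := (Rintegral leb_itv setT f).

Lemma leb_itvC : leb_itv (~` `[0, c[%classic) = 0%E.
Proof. by rewrite /leb_itv/= /mfrestr /mrestr setICl measure0. Qed.

Lemma Rint_leb_itv a b : 0 <= a -> a <= b -> b <= c ->
  E (\1_(`[a, b[%classic)) = b - a.
Proof.
move=> a0 ab bc; rewrite Rint_indic//.
rewrite /leb_itv/= /mfrestr /mrestr.
rewrite setIidl; last first.
  move=> x /=; rewrite !in_itv/= => /andP[ax xb].
  by rewrite (le_trans a0 ax) (lt_le_trans xb bc).
rewrite lebesgue_measure_itv/= lte_fin; case: ltP => //= ba.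
by apply/esym/eqP; rewrite subr_eq0 eq_le ba ab.
Qed.

Lemma Rint_step n (p : nat -> R) (d : nat -> R) :
  {homo p : i j / (i <= j)%N >-> i <= j} -> p 0 = 0 -> p n = c ->
  E (fun s => \sum_(i < n) d i * \1_(`[p i, p i.+1[%classic) s) =
  \sum_(i < n) d i * (p i.+1 - p i).
Proof.
move=> hp p0 pn; rewrite Rint_sum => [|i _]; last first.
  by apply: bmeasZ; apply: bmeas_indic; exact: measurable_itv.
apply: eq_bigr => i _; rewrite RintZ; last by apply: bmeas_indic; exact: measurable_itv.
rewrite Rint_leb_itv//; first by rewrite -p0 hp.
- exact: hp.
- by rewrite -pn hp.
Qed.

Lemma Rint_quantile_step n (p : nat -> R) (d : nat -> R) (f : R -> R) :
  {homo p : i j / (i <= j)%N >-> i <= j} -> p 0 = 0 -> p n = c -> bmeas f ->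
  (forall j s, (j < n)%N -> p j <= s < p j.+1 -> f s = d j) ->
  E f = \sum_(i < n) d i * (p i.+1 - p i).
Proof.
move=> hp p0 pn bf fd; rewrite -Rint_step//.
have bs : bmeas (fun s => \sum_(i < n) d i * \1_(`[p i, p i.+1[%classic) s).
  apply: bmeas_sum => i _; apply: bmeasZ.
  by apply: bmeas_indic; exact: measurable_itv.
have feq s : `[0, c[%classic s ->
    f s = \sum_(i < n) d i * \1_(`[p i, p i.+1[%classic) s.
  move=> Ds; have /partition_find[j jn js] : p 0 <= s < p n.
    by move: Ds; rewrite p0 pn /= in_itv.
  by rewrite (step_sum hp d jn js) (fd _ _ jn js).
apply/eqP; rewrite eq_le; apply/andP; split; apply: (le_Rint_on mD leb_itvC) => //;
  by move=> s Ds; rewrite feq.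
Qed.

Section Riemann.
Variables (Q phi : R -> R) (B L : R).
Hypotheses (Q_homo : {homo Q : x y / x <= y}) (QB : forall s, 0 <= Q s <= B).
Hypotheses (bphi : bmeas phi) (L0 : 0 <= L).
Hypothesis phi_lip : forall x y, `|phi x - phi y| <= L * `|x - y|.

Definition riemann (Q phi : R -> R) K :=
  \sum_(i < K.+1) phi (Q (i%:R * (c / K.+1%:R))) * (c / K.+1%:R).

(** On a cell of the partition the error is at most [L] times the increment of [Q], by monotonicity,
    and the increments telescope to at most [B]. No continuity of [Q] enters, and the bound depends
    on [Q] only through [B]. *)
Lemma riemannP K : `|E (fun s => phi (Q s)) - riemann Q phi K| <= L * B * (c / K.+1%:R).
Proof.
pose h := c / K.+1%:R; have h0 : 0 <= h by rewrite divr_ge0.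
pose p i : R := i%:R * h.
have hp : {homo p : i j / (i <= j)%N >-> i <= j}.
  by move=> i j ij; rewrite ler_wpM2r// ler_nat.
have p0 : p 0 = 0 by rewrite /p mul0r.
have pK : p K.+1 = c by rewrite /p /h mulrCA mulfV ?mulr1.
have pS i : p i.+1 - p i = h by rewrite /p -natr1 mulrDl mul1r addrAC subrr add0r.
have bQ : bmeas (fun s => phi (Q s)).
  apply: bmeas_comp => //; apply: nondecreasing_measurable => //.
have -> : riemann Q phi K =
    E (fun s => \sum_(i < K.+1) phi (Q (p i)) * \1_(`[p i, p i.+1[%classic) s).
  by rewrite (Rint_step (fun i => phi (Q (p i))))//; apply: eq_bigr => i _; rewrite pS.
have bs (d : nat -> R) :
    bmeas (fun s => \sum_(i < K.+1) d i * \1_(`[p i, p i.+1[%classic) s).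
  apply: bmeas_sum => i _; apply: bmeasZ.
  by apply: bmeas_indic; exact: measurable_itv.
have bstep := bs (fun i => phi (Q (p i))); rewrite /= in bstep.
have bdiff : bmeas (fun s => phi (Q s) -
    \sum_(i < K.+1) phi (Q (p i)) * \1_(`[p i, p i.+1[%classic) s).
  exact: bmeasB bQ bstep.
rewrite -(RintB leb_itv bQ bstep).
apply: le_trans; first exact: (Rint_norm leb_itv bdiff).
pose d i := L * (Q (p i.+1) - Q (p i)).
apply: (@le_trans _ _ (E (fun s => \sum_(i < K.+1) d i * \1_(`[p i, p i.+1[%classic) s))).
  apply: (le_Rint_on mD leb_itvC).
  - exact: bmeas_norm bdiff.
  - exact: bs.
  move=> s Ds; have /partition_find[j jn js] : p 0 <= s < p K.+1.
    by move: Ds; rewrite p0 pK /= in_itv.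
  rewrite (step_sum hp d jn js) (step_sum hp (fun i => phi (Q (p i))) jn js).
  rewrite (le_trans (phi_lip _ _))// ler_wpM2l//.
  have /andP[js1 /ltW js2] := js.
  by rewrite ger0_norm ?subr_ge0 ?Q_homo// lerD2r Q_homo.
rewrite Rint_step//.
rewrite (eq_bigr (fun i : 'I_K.+1 => (Q (p i.+1) - Q (p i)) * (L * h))); last first.
  by move=> i _; rewrite pS /d mulrAC mulrC.
rewrite -mulr_suml -(big_mkord xpredT (fun i => Q (p i.+1) - Q (p i))) telescope_sumr//.
rewrite -/h mulrAC [leRHS]mulrC ler_wpM2r ?mulr_ge0//.
have /andP[_ h1] := QB (p K.+1); have /andP[h2 _] := QB (p 0%N); lra.
Qed.

End Riemann.

Section DiscreteQuantile.
Variables (M : nat) (w : nat -> R) (del : R).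
Hypotheses (w0 : forall j, 0 <= w j) (del0 : 0 <= del).
Hypothesis wc : \sum_(j < M) w j = c.

(* [quantile] is the quantile function of the discrete measure with mass [w j] at
   [j * del]: its law under Lebesgue measure on [0, c[ is that measure. *)
Definition cumul j := \sum_(i < j) w i.
Definition quantile s : R := \sum_(j < M) (if cumul j.+1 <= s then del else 0).

Lemma cumul_homo : {homo cumul : i j / (i <= j)%N >-> i <= j}.
Proof.
move=> i j /subnK <-; elim: (j - i)%N => // k IHk.
by rewrite (le_trans IHk)// addSn /cumul big_ord_recr/= lerDl.
Qed.

Lemma quantile_homo : {homo quantile : x y / x <= y}.
Proof.
move=> x y xy; apply: ler_sum => j _; case: ifP => [jx|_]; last by case: ifP.
by rewrite (le_trans jx xy).
Qed.

Lemma quantile_bound s : 0 <= quantile s <= M%:R * del.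
Proof.
rewrite sumr_ge0/= => [|i _]; last by case: ifP.
rewrite mulr_natl -[X in _ *+ X]card_ord -sumr_const; apply: ler_sum => i _.
by case: ifP.
Qed.

Lemma quantileE j s : (j < M)%N -> cumul j <= s < cumul j.+1 ->
  quantile s = j%:R * del.
Proof.
move=> jM /andP[js sj]; rewrite /quantile.
transitivity (\sum_(i < M | (i < j)%N) del).
  rewrite [RHS]big_mkcond/=; apply: eq_bigr => i _; case: ifP => [is_|].
    case: ltnP => // ji; have := le_lt_trans is_ sj.
    by rewrite ltNge cumul_homo.
  by case: ltnP => // ij; rewrite (le_trans _ js)// cumul_homo.
rewrite -(big_ord_widen _ (fun=> del) (ltnW jM)).
by rewrite sumr_const card_ord mulr_natl.
Qed.

Lemma Rint_quantile phi : bmeas phi ->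
  E (fun s => phi (quantile s)) = \sum_(j < M) phi (j%:R * del) * w j.
Proof.
move=> bphi; rewrite (@Rint_quantile_step M cumul (fun j => phi (j%:R * del)))//.
- by apply: eq_bigr => j _; rewrite /cumul big_ord_recr/= addrAC subrr add0r.
- exact: cumul_homo.
- by rewrite /cumul big_ord0.
- apply: bmeas_comp => //; apply: nondecreasing_measurable => //; exact: quantile_homo.
- by move=> j s jM js; rewrite (quantileE jM js).
Qed.

End DiscreteQuantile.
End Quantile.

Section FinitePushforward.
Context {R : realType} d d' (T : measurableType d) (T' : measurableType d').
Variables (m : {finite_measure set T -> \bar R}) (h : T -> T').
Hypothesis mh : measurable_fun setT h.

Definition fpushforward := pushforward m h.

Let fpushforward0 : fpushforward set0 = 0%E.
Proof. exact: measure0. Qed.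

Let fpushforward_ge0 A : (0 <= fpushforward A)%E.
Proof. exact: measure_ge0. Qed.

Let fpushforward_sigma_additive : semi_sigma_additive fpushforward.
Proof. exact: measure_semi_sigma_additive. Qed.

HB.instance Definition _ := isMeasure.Build _ _ _ fpushforward
  fpushforward0 fpushforward_ge0 fpushforward_sigma_additive.

Let fpushforward_fin : fin_num_fun fpushforward.
Proof.
move=> A mA; apply: fin_num_measure.
by rewrite -[X in measurable X]setTI; exact: mh.
Qed.

HB.instance Definition _ := Measure_isFinite.Build _ _ _ fpushforward
  fpushforward_fin.

Lemma finite_pushforward : exists m' : {finite_measure set T' -> \bar R},
  forall A, m' A = m (h @^-1` A).
Proof. by exists fpushforward. Qed.

End FinitePushforward.

Lemma ultra_bounded_cvg {R : realType} (U : set_system nat) (u : nat -> R) (B : R) :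
  UltraFilter U -> (forall n, 0 <= u n <= B) -> exists l : R, u n @[n --> U] --> l.
Proof.
move=> UU uB.
have /(_ (u @ U)) := @segment_compact R 0 B.
case=> [|l [_ lU]].
  apply: (@filterS _ U _ setT _ _ filterT) => n _.
  by rewrite /= in_itv/=; exact: uB.
exists l => V lV; have [//|UV] := in_ultra_setVsetC (u @^-1` V) UU.
have [] := lU (~` V) V UV lV.
by move=> x [].
Qed.

(** * Fejer sums sampled at roots of unity *)

Section RootSums.
Context {R : realType}.

Lemma cos_sin_2pi_int (l : int) :
  cos (l%:~R * (2 * pi)) = 1 :> R /\ sin (l%:~R * (2 * pi)) = 0 :> R.
Proof.
have nat_case (n : nat) : cos (n%:R * (2 * pi)) = 1 :> R /\ sin (n%:R * (2 * pi)) = 0 :> R.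
  elim: n => [|n [IHc IHs]]; first by rewrite mul0r cos0 sin0.
  have [c2 s2] : cos (2 * pi) = 1 :> R /\ sin (2 * pi) = 0 :> R.
    by rewrite mulr_natl cos2pi sin2pi.
  rewrite -natr1 mulrDl mul1r (cosD (n%:R * _)) (sinD (n%:R * _)) IHc IHs c2 s2.
  by split; ring.
case: l => n; first exact: nat_case.
by rewrite NegzE intrN mulNr cosN sinN; have [-> ->] := nat_case n.+1; rewrite oppr0.
Qed.

Lemma cos_neq1 (x : R) : 0 < `|x| < 2 * pi -> cos x != 1.
Proof.
rewrite -cos_norm => /andP[x0 x2].
have -> : `|x| = (`|x| / 2) *+ 2 by rewrite -mulr_natl; field.
have : 0 < sin (`|x| / 2) by apply: sin_gt0_pi; apply/andP; split; lra.
rewrite cos_mulr2n -[cos _ ^+ 2](addrK (sin (`|x| / 2) ^+ 2)) cos2Dsin2.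
set s := sin _ => s0; have : 0 < s ^+ 2 by rewrite exprn_gt0.
move=> s2; apply/negP => /eqP h; move: h; rewrite mulr2n; lra.
Qed.

(** The geometric series of [exp (i a)] in real form. Shifting the index shows that the vector of
    the two sums is fixed by the rotation of angle [a]; the rotation minus the identity has
    determinant [(1 - cos a) ^+ 2 + sin a ^+ 2], which is not zero. *)
Lemma root_sums (M : nat) (a : R) : cos (M%:R * a) = 1 -> sin (M%:R * a) = 0 ->
  cos a != 1 ->
  \sum_(j < M) cos (j%:R * a) = 0 /\ \sum_(j < M) sin (j%:R * a) = 0.
Proof.
move=> cM sM ca.
set Cs := \sum_(j < M) cos _; set Ss := \sum_(j < M) sin _.
have shift (f : nat -> R) : f M = f 0%N ->
    \sum_(j < M) f j.+1 = \sum_(j < M) f j.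
  move=> fM; apply: (@addrI _ (f 0%N)); transitivity (\sum_(j < M.+1) f j).
    by rewrite big_ord_recl.
  by rewrite big_ord_recr/= fM addrC.
have eC : Cs = Cs * cos a - Ss * sin a.
  rewrite {1}/Cs -[LHS](shift (fun j => cos (j%:R * a))); last by rewrite mul0r cos0.
  rewrite !mulr_suml -sumrB; apply: eq_bigr => j _.
  by rewrite -natr1 mulrDl mul1r cosD.
have eS : Ss = Ss * cos a + Cs * sin a.
  rewrite {1}/Ss -[LHS](shift (fun j => sin (j%:R * a))); last by rewrite mul0r sin0.
  rewrite !mulr_suml -big_split; apply: eq_bigr => j _.
  by rewrite -natr1 mulrDl mul1r sinD.
have nz : (1 - cos a) ^+ 2 + sin a ^+ 2 != 0.
  apply: lt0r_neq0; rewrite ltr_wpDr ?sqr_ge0//.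
  by rewrite lt0r sqr_ge0 andbT sqrf_eq0 subr_eq0 eq_sym.
split; apply/eqP; rewrite -(mulrI_eq0 _ (mulfI nz)); apply/eqP.
  transitivity ((1 - cos a) * (Cs - (Cs * cos a - Ss * sin a))
     - sin a * (Ss - (Ss * cos a + Cs * sin a))); first by ring.
  by rewrite -eC -eS !subrr !mulr0 subr0.
transitivity ((1 - cos a) * (Ss - (Ss * cos a + Cs * sin a))
   + sin a * (Cs - (Cs * cos a - Ss * sin a))); first by ring.
by rewrite -eC -eS !subrr !mulr0 addr0.
Qed.

End RootSums.

Section Fejer.
Context {R : realType}.
Variable r : int -> R.
Hypothesis r_sym : forall k, r (- k) = r k.
Hypothesis r_pos : forall (N : nat) (t : R), 0 <= \sum_(a < N) \sum_(b < N)
  r (a%:Z - b%:Z) * cos ((a%:Z - b%:Z)%:~R * t).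
Variable n : nat.
Let N := n.+1.
Let M := (2 * N)%N.
Let del : R := 2 * pi / M%:R.

Let M0 : M%:R != 0 :> R.
Proof. by rewrite pnatr_eq0. Qed.

(** Orthogonality of the characters of Z/M: for [0 < |l| < M] the angle [l * del] lies strictly
    between 0 and [2 * pi] in absolute value, so its cosine is not 1. *)
Let root_cos (l : int) : (`|l| < M)%N ->
  \sum_(j < M) cos (l%:~R * (j%:R * del)) = M%:R * (l == 0)%:R :> R /\
  \sum_(j < M) sin (l%:~R * (j%:R * del)) = 0 :> R.
Proof.
move=> lM; have [->|l0] := eqVneq l 0.
  split; last by rewrite big1// => j _; rewrite mul0r sin0.
  rewrite (eq_bigr (fun=> 1)); last by move=> j _; rewrite mul0r cos0.
  by rewrite sumr_const card_ord mulr1.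
have e (j : nat) : l%:~R * (j%:R * del) = j%:R * (l%:~R * del) by rewrite mulrCA.
rewrite mulr0.
under eq_bigr do rewrite e; under [X in _ /\ X = _]eq_bigr do rewrite e.
have Ma : M%:R * (l%:~R * del) = l%:~R * (2 * pi).
  by rewrite mulrCA /del; congr (_ * _); rewrite mulrC divfK.
apply: root_sums; rewrite ?Ma; [exact: (cos_sin_2pi_int l).1|exact: (cos_sin_2pi_int l).2|].
have pi0 := pi_gt0 R; have Mp : 0 < M%:R :> R by rewrite ltr0n.
have dp : 0 < del by rewrite divr_gt0// mulr_gt0.
apply: cos_neq1; rewrite normrM (gtr0_norm dp) mulr_gt0 ?normr_gt0 ?intr_eq0//=.
have <- : M%:R * del = 2 * pi by rewrite /del mulrC divfK.
rewrite ltr_pM2r// -intr_norm.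
by rewrite -(ltr_nat R) in lM; apply: le_lt_trans lM; rewrite -abszE.
Qed.

(* [(N M)^-1 * || \sum_(a < N) exp (- i a t) X_a ||^2] at [t = 2 pi j / M], for a
   sequence [X] with correlations [r].  With [M = 2 N] points, frequencies less
   than [N] are not aliased. *)
Definition fejer_weight (j : nat) : R :=
  (N%:R * M%:R)^-1 * \sum_(a < N) \sum_(b < N)
  r (a%:Z - b%:Z) * cos ((a%:Z - b%:Z)%:~R * (j%:R * del)).

Lemma fejer_weight_ge0 j : 0 <= fejer_weight j.
Proof. by rewrite mulr_ge0// invr_ge0 mulr_ge0. Qed.

Let abs_ab (a b : 'I_N) k : (k < N)%N ->
  (`|(a%:Z - b%:Z - k%:Z)%R| < M)%N /\ (`|(a%:Z - b%:Z + k%:Z)%R| < M)%N.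
Proof. by have := ltn_ord a; have := ltn_ord b; rewrite /M; lia. Qed.

Lemma sum_diag (k : nat) : (k < N)%N ->
  \sum_(a < N) \sum_(b < N) r (a%:Z - b%:Z) * (a%:Z - b%:Z - k%:Z == 0)%:R =
  (N - k)%:R * r k.
Proof.
move=> kN; rewrite exchange_big/=.
rewrite (eq_bigr (fun b : 'I_N => (b < N - k)%:R * r k)); last first.
  move=> b _; have [bk|bk] := ltnP.
    have abN : (b + k < N)%N by lia.
    rewrite (bigD1 (Ordinal abN))//= big1 => [|a]; last first.
      rewrite -val_eqE/= => ab; case: eqP => h; rewrite ?mulr0//.
      by exfalso; move/eqP: ab; apply; lia.
    by rewrite (_ : (_ - b%:Z) = k%:Z) ?subrr ?eqxx ?mulr1 ?addr0 ?mul1r//; lia.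
  rewrite mul0r big1// => a _; case: eqP => h; rewrite ?mulr0//.
  by exfalso; have := ltn_ord a; lia.
rewrite -mulr_suml; congr (_ * _).
transitivity (\sum_(b < N | (b < N - k)%N) (1 : R)).
  by rewrite [RHS]big_mkcond/=; apply: eq_bigr => b _; case: ltnP.
by rewrite -(big_ord_widen N (fun=> 1)) ?leq_subr// sumr_const card_ord.
Qed.

(** The product of cosines is half a sum of two, and orthogonality keeps only the diagonals
    [a - b = k] and [a - b = - k]. They contribute equally as [r] is even, which cancels the half;
    each has [N - k] entries, whence the Fejer factor. *)
Lemma fejer_cos (k : nat) : (k < N)%N ->
  \sum_(j < M) cos (k%:~R * (j%:R * del)) * fejer_weight j = (N - k)%:R / N%:R * r k.
Proof.
move=> kN.
have trig (x y : R) : cos x * cos y = 2^-1 * (cos (x - y) + cos (x + y)).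
  by rewrite cosB cosD; field.
transitivity ((N%:R * M%:R)^-1 * (2^-1 * (M%:R * \sum_(a < N) \sum_(b < N)
    r (a%:Z - b%:Z) * ((a%:Z - b%:Z - k%:Z == 0)%:R + (a%:Z - b%:Z + k%:Z == 0)%:R)))).
  under eq_bigr do rewrite /fejer_weight mulrCA; rewrite -mulr_sumr; congr (_ * _).
  rewrite mulrA mulr_sumr.
  under eq_bigr do rewrite mulr_sumr; rewrite exchange_big/=; apply: eq_bigr => a _.
  under eq_bigr do rewrite mulr_sumr; rewrite exchange_big/= mulr_sumr; apply: eq_bigr => b _.
  have [h1 h2] := abs_ab a b kN.
  have [e1 _] := root_cos h1; have [e2 _] := root_cos h2.
  transitivity (r (a%:Z - b%:Z) * (2^-1 *
      (\sum_(j < M) cos ((a%:Z - b%:Z - k%:Z)%:~R * (j%:R * del)) +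
       \sum_(j < M) cos ((a%:Z - b%:Z + k%:Z)%:~R * (j%:R * del))))); last first.
    by rewrite e1 e2; ring.
  rewrite -big_split/= !mulr_sumr; apply: eq_bigr => j _.
  rewrite mulrCA; congr (_ * _); rewrite mulrC trig.
  by rewrite -mulrBl -mulrDl -intrB -intrD.
have e : \sum_(a < N) \sum_(b < N) r (a%:Z - b%:Z) *
    ((a%:Z - b%:Z - k%:Z == 0)%:R + (a%:Z - b%:Z + k%:Z == 0)%:R) =
    (N - k)%:R * r k *+ 2.
  rewrite mulr2n -{1}(sum_diag kN) -(sum_diag kN).
  rewrite [X in _ = _ + X]exchange_big/= -big_split; apply: eq_bigr => a _ /=.
  rewrite -big_split; apply: eq_bigr => b _ /=.
  rewrite mulrDr; congr (_ + _); rewrite -r_sym opprB; congr (_ * _%:R).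
  by apply/eqP/eqP; lia.
rewrite e -mulr_natl; have NN : N%:R != 0 :> R by rewrite pnatr_eq0.
by field; rewrite NN M0.
Qed.

Lemma fejer_sin (k : nat) : (k < N)%N ->
  \sum_(j < M) sin (k%:~R * (j%:R * del)) * fejer_weight j = 0.
Proof.
move=> kN.
have trig (x y : R) : sin x * cos y = 2^-1 * (sin (y + x) - sin (y - x)).
  by rewrite sinB sinD; field.
under eq_bigr do rewrite /fejer_weight mulrCA; rewrite -mulr_sumr.
rewrite [X in _ * X](_ : _ = 0) ?mulr0//.
under eq_bigr do rewrite mulr_sumr; rewrite exchange_big/= big1// => a _.
under eq_bigr do rewrite mulr_sumr; rewrite exchange_big/= big1// => b _.
have [h1 h2] := abs_ab a b kN.
have [_ e1] := root_cos h1; have [_ e2] := root_cos h2.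
transitivity (r (a%:Z - b%:Z) * (2^-1 *
    (\sum_(j < M) sin ((a%:Z - b%:Z + k%:Z)%:~R * (j%:R * del)) -
     \sum_(j < M) sin ((a%:Z - b%:Z - k%:Z)%:~R * (j%:R * del))))); last first.
  by rewrite e1 e2 subrr !mulr0.
rewrite -sumrB/= !mulr_sumr; apply: eq_bigr => j _.
rewrite mulrCA; congr (_ * _); rewrite trig.
by rewrite -mulrBl -mulrDl -intrB -intrD.
Qed.

End Fejer.

(** * Herglotz's theorem *)

Section Herglotz.
Context {R : realType}.
Local Notation C := R[i].

Lemma lipschitz1_of_derive (f df : R -> R) :
  (forall x : R, is_derive x 1 f (df x)) -> (forall x, `|df x| <= 1) ->
  forall k x y, `|f (k * x) - f (k * y)| <= `|k| * `|x - y|.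
Proof.
move=> fdf dfL k x y; rewrite -normrM mulrBr.
move: (k * x) (k * y) => {k x y}.
have H x y : x <= y -> `|f y - f x| <= `|y - x|.
  move=> xy; have [|c _ ->] := @MVT_segment R f df x y xy (fun t _ => fdf t).
  - apply: derivable_within_continuous => t _.
    by case: (fdf t).
  - by rewrite normrM ler_piMl.
move=> x y; have [/H|/ltW/H//] := leP x y.
by rewrite distrC [`|y - x|]distrC.
Qed.

Lemma cos_lipschitz (k x y : R) : `|cos (k * x) - cos (k * y)| <= `|k| * `|x - y|.
Proof.
apply: (@lipschitz1_of_derive cos (fun x => - sin x)) => t.
by rewrite normrN ler_norml sin_geN1 sin_le1.
Qed.

Lemma sin_lipschitz (k x y : R) : `|sin (k * x) - sin (k * y)| <= `|k| * `|x - y|.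
Proof.
apply: (@lipschitz1_of_derive sin cos) => t.
by rewrite ler_norml cos_geN1 cos_le1.
Qed.

Lemma bmeas_cos (k : R) : bmeas (fun x : R => cos (k * x)).
Proof.
apply: (@bmeas_comp _ _ _ _ _ cos); last exact: mulrl_measurable.
split; first by apply: continuous_measurable_fun; exact: continuous_cos.
by exists 1 => x; rewrite ler_norml cos_geN1 cos_le1.
Qed.

Lemma bmeas_sin (k : R) : bmeas (fun x : R => sin (k * x)).
Proof.
apply: (@bmeas_comp _ _ _ _ _ sin); last exact: mulrl_measurable.
split; first by apply: continuous_measurable_fun; exact: continuous_sin.
by exists 1 => x; rewrite ler_norml sin_geN1 sin_le1.
Qed.

Lemma cvg_riemann (c : R) (U : set_system nat) (Q_ : nat -> R -> R) (Q phi : R -> R) K :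
  ProperFilter U -> continuous phi -> (forall s, Q_ n s @[n --> U] --> Q s) ->
  riemann c (Q_ n) phi K @[n --> U] --> riemann c Q phi K.
Proof.
move=> UU cphi cQ; rewrite /riemann.
elim: (index_enum _) => [|i s IHs].
  rewrite big_nil; under eq_fun do rewrite big_nil.
  exact: cvg_cst.
rewrite big_cons; under eq_fun do rewrite big_cons.
apply: cvgD IHs; apply: cvgM; last exact: cvg_cst.
by apply: continuous_cvg; [exact: cphi|exact: cQ].
Qed.

Section Measure.
Variable r : int -> R.
Hypothesis r_sym : forall k, r (- k) = r k.
Hypothesis r_pos : forall (N : nat) (t : R), 0 <= \sum_(a < N) \sum_(b < N)
  r (a%:Z - b%:Z) * cos ((a%:Z - b%:Z)%:~R * t).

Let c := r 0.

Let c0 : 0 <= c.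
Proof. by have := r_pos 1 0; rewrite !big_ord1 subrr mul0r cos0 mulr1. Qed.

Let M n := (2 * n.+1)%N.
Let del n : R := 2 * pi / (M n)%:R.
Let w n := fejer_weight r n.
Let Q_ n := quantile (M n) (w n) (del n).

Let del0 n : 0 <= del n.
Proof. by rewrite divr_ge0// mulr_ge0// pi_ge0. Qed.

Let w0 n j : 0 <= w n j.
Proof. exact: fejer_weight_ge0. Qed.

Let w_sum n : \sum_(j < M n) w n j = c.
Proof.
have := @fejer_cos _ _ r_sym n 0 (ltn0Sn n).
rewrite subn0 divff ?pnatr_eq0// mul1r => h.
by rewrite -[RHS]h; apply: eq_bigr => j _; rewrite mul0r cos0 mul1r.
Qed.

Let Q_bound n s : 0 <= Q_ n s <= 2 * pi.
Proof.
have := quantile_bound (M n) (w n) (del0 n) s.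
have -> : (M n)%:R * del n = 2 * pi by rewrite mulrC divfK// pnatr_eq0.
by [].
Qed.

Let E f := Rintegral (leb_itv c) setT f.

Lemma fejer_limit (U : set_system nat) (Q : R -> R) (phi : R -> R) (L l : R) :
  UltraFilter U -> \oo `<=` U -> (forall s, Q_ n s @[n --> U] --> Q s) ->
  bmeas phi -> continuous phi -> 0 <= L ->
  (forall x y, `|phi x - phi y| <= L * `|x - y|) ->
  \sum_(j < M n) phi (j%:R * del n) * w n j @[n --> \oo] --> l ->
  E (fun s => phi (Q s)) = l.
Proof.
move=> UU Uoo cQ bphi cphi L0 lip cl.
have Qh : {homo Q : x y / x <= y}.
  move=> x y xy; apply: ler_cvg_to (cQ x) (cQ y) _.
  by apply: filterE => n; exact: quantile_homo.
have QB s : 0 <= Q s <= 2 * pi.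
  apply/andP; split.
    apply: ler_cvg_to (cvg_cst _) (cQ s) _.
    by apply: filterE => n; have /andP[] := Q_bound n s.
  apply: ler_cvg_to (cQ s) (cvg_cst _) _.
  by apply: filterE => n; have /andP[] := Q_bound n s.
have EQ_ n : E (fun s => phi (Q_ n s)) = \sum_(j < M n) phi (j%:R * del n) * w n j.
  exact: Rint_quantile.
have clU : E (fun s => phi (Q_ n s)) @[n --> U] --> l.
  by under eq_fun do rewrite EQ_; move=> V lV; exact: Uoo _ (cl V lV).
(* For fixed [K] the Riemann sum is finite and passes to the limit along [U]. The error bound for
   [Q_ n] does not depend on [n], so [l] and the integral for [Q] are equally close to the Riemann
   sum of [Q]. *)
have bd K : `|E (fun s => phi (Q s)) - l| <= 2 * (L * (2 * pi) * c) * K.+1%:R^-1.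
  have h1 := riemannP c0 Qh QB bphi L0 lip K.
  have h2 : `|l - riemann c Q phi K| <= L * (2 * pi) * (c / K.+1%:R).
    have cr := @cvg_riemann c U _ _ _ K (@ultra_proper _ _ UU) cphi cQ.
    have nc : `|E (fun s => phi (Q_ n s)) - riemann c (Q_ n) phi K| @[n --> U]
        --> `|l - riemann c Q phi K| by apply: cvg_norm; apply: cvgB.
    apply: ler_cvg_to nc (cvg_cst _) _.
    apply: filterE => n.
    exact: (riemannP c0 (quantile_homo (M n) (w n) (del0 n)) (Q_bound n) bphi L0 lip).
  rewrite -/(E _) in h1.
  have -> : E (fun s => phi (Q s)) - l =
    (E (fun s => phi (Q s)) - riemann c Q phi K) - (l - riemann c Q phi K).
    by rewrite opprB addrA subrK.
  rewrite (le_trans (ler_normB _ _))//.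
  have -> : 2 * (L * (2 * pi) * c) / K.+1%:R =
    L * (2 * pi) * (c / K.+1%:R) + L * (2 * pi) * (c / K.+1%:R) by ring.
  exact: lerD.
apply/eqP; rewrite -subr_eq0 -normr_le0.
have cK : 2 * (L * (2 * pi) * c) * K.+1%:R^-1 @[K --> \oo] --> (0 : R).
  rewrite -[X in _ --> X](mulr0 (2 * (L * (2 * pi) * c))).
  by apply: cvgM; [exact: cvg_cst|exact: cvg_harmonic].
by apply: ler_cvg_to (cvg_cst _) cK _; apply: nearW.
Qed.

Lemma cvg_fejer_cos (k : nat) :
  \sum_(j < M n) cos (k%:~R * (j%:R * del n)) * w n j @[n --> \oo] --> r k.
Proof.
have : (1 - k%:R * n.+1%:R^-1) * r k @[n --> \oo] --> r k.
  rewrite [X in _ --> X](_ : r k = (1 - k%:R * 0) * r k); last first.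
    by rewrite mulr0 subr0 mul1r.
  apply: cvgM; last exact: cvg_cst.
  apply: cvgB; first exact: cvg_cst.
  by apply: cvgM; [exact: cvg_cst|exact: cvg_harmonic].
apply: cvg_trans; apply: near_eq_cvg; near=> n.
have kn : (k < n.+1)%N by near: n; exact: nbhs_infty_ge.
rewrite fejer_cos// natrB 1?ltnW//.
by congr (_ * _); rewrite mulrBl divff ?pnatr_eq0.
Unshelve. all: by end_near. Qed.

Lemma cvg_fejer_sin (k : nat) :
  \sum_(j < M n) sin (k%:~R * (j%:R * del n)) * w n j @[n --> \oo] --> 0.
Proof.
apply: cvg_near_cst; near=> n.
by apply: fejer_sin => //; near: n; exact: nbhs_infty_ge.
Unshelve. all: by end_near. Qed.

(* The spectral measure is a weak limit of the Fejer measures.  Weak compactness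
   comes for free from a pointwise limit of the quantile functions along an
   ultrafilter: Riemann sums of [phi o Q] converge uniformly over all monotone
   [Q] with values in a bounded interval. *)
Theorem herglotz : exists sigma : {finite_measure set (circleB R) -> \bar R},
  forall k : int, cintegral sigma (fun z : circleB R => val z ^ k) = (r k)%:C%C.
Proof.
have [U [UU Uoo]] := ultraFilterLemma (@eventually_filter).
have [Q cQ] : exists Q : R -> R, forall s, Q_ n s @[n --> U] --> Q s.
  have /choice[Q QP] := fun s => ultra_bounded_cvg UU (Q_bound ^~ s).
  by exists Q.
have Qh : {homo Q : x y / x <= y}.
  move=> x y xy; apply: ler_cvg_to (cQ x) (cQ y) _.
  by apply: filterE => n; exact: quantile_homo.
have mQ : measurable_fun setT (fun s => expi (Q s)).
  apply: measurableT_comp; first exact: measurable_expi.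
  exact: nondecreasing_measurable.
have [sigma sE] := @finite_pushforward R _ _ _ _ (leb_itv c) _ mQ.
exists sigma => k.
have -> : cintegral sigma (fun z : circleB R => val z ^ k) =
   Complex (E (fun s => cos (k%:~R * Q s))) (E (fun s => sin (k%:~R * Q s))).
  rewrite (@cint_pushforward _ _ _ _ _ (leb_itv c) sigma _ _ mQ (fun A _ => sE A)
    (cbmeas_circle_exprz k)).
  by congr Complex; apply: eq_Rint => s; rewrite expi_exprz.
have cc (l : R) : continuous (fun x : R => cos (l * x)).
  move=> x; apply: continuous_comp; last exact: continuous_cos.
  exact: mulrl_continuous.
have cs (l : R) : continuous (fun x : R => sin (l * x)).
  move=> x; apply: continuous_comp; last exact: continuous_sin.
  exact: mulrl_continuous.
have Ecos (l : nat) : E (fun s => cos (l%:~R * Q s)) = r l.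
  apply: (fejer_limit UU Uoo cQ (bmeas_cos _) (cc _) _ (cos_lipschitz _)) => //.
  exact: cvg_fejer_cos.
have Esin (l : nat) : E (fun s => sin (l%:~R * Q s)) = 0.
  apply: (fejer_limit UU Uoo cQ (bmeas_sin _) (cs _) _ (sin_lipschitz _)) => //.
  exact: cvg_fejer_sin.
have bsin : bmeas (fun s => sin ((k : int)%:~R * Q s)).
  by apply: (bmeas_comp (bmeas_sin _)); exact: nondecreasing_measurable.
case: k bsin => l bsin; first by rewrite Ecos Esin.
rewrite NegzE r_sym; congr Complex.
  rewrite -Ecos; apply: eq_Rint => s.
  by rewrite intrN mulNr cosN.
rewrite -[RHS]oppr0 -(Esin l.+1) -[RHS](RintN (leb_itv c)).
  by apply: eq_Rint => s; rewrite intrN mulNr sinN.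
by apply: (bmeas_comp (bmeas_sin _)); exact: nondecreasing_measurable.
Qed.

End Measure.
End Herglotz.

(** * Uniqueness of Fourier coefficients and orthogonality *)

Section TrigClosure.
Context {R : realType}.
Local Notation C := R[i].
Local Notation Re := complex.Re.
Local Notation Im := complex.Im.
Local Notation circleB := (circleB R).
Implicit Types f g h : circleB -> R.

(** A functional monotone class: an identity linear in the integrals passes from monomials to the
    whole class by dominated convergence. Being inductive, the class iterates bounded pointwise
    limits as often as needed to reach the indicators of all Borel sets. *)
Inductive trig_closure : (circleB -> R) -> Prop :=
| trig_monomial (c : C) (k : int) : trig_closure (fun z => Re (c * val z ^ k))
| trig_add f g : trig_closure f -> trig_closure g ->
    trig_closure (fun z => f z + g z)
| trig_lim (f_ : nat -> circleB -> R) f (M : R) :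
    (forall n, trig_closure (f_ n)) -> (forall n z, `|f_ n z| <= M) ->
    (forall z, f_ n z @[n --> \oo] --> f z) -> trig_closure f.

Lemma trig_ext f g : f =1 g -> trig_closure f -> trig_closure g.
Proof. by move=> /funext ->. Qed.

Lemma bmeas_trig_monomial (c : C) (k : int) :
  bmeas (fun z : circleB => Re (c * val z ^ k)).
Proof.
have [] // : cbmeas (fun z : circleB => c * val z ^ k).
by apply: cbmeasM; [exact: cbmeas_cst|exact: cbmeas_circle_exprz].
Qed.

Lemma bmeas_trig f : trig_closure f -> bmeas f.
Proof.
elim=> [c k|{}f g _ bf _ bg|f_ {}f M _ bf fM cf].
- exact: bmeas_trig_monomial.
- exact: bmeasD.
- exact: bmeas_cvg bf fM cf.
Qed.

Lemma trig_cst a : trig_closure (fun=> a).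
Proof.
by apply: trig_ext (trig_monomial a%:C%C 0) => z; rewrite expr0z mulr1.
Qed.

(** For monomials this is [Re a * Re b = (Re (a * b) + Re (a * conjc b)) / 2], where on the circle
    the conjugate of [z ^ l] is [z ^ (- l)]. *)
Lemma trig_monomialM (c : C) (k : int) f :
  trig_closure f -> trig_closure (fun z => Re (c * val z ^ k) * f z).
Proof.
elim=> [e l|{}f g _ bf _ bg|f_ {}f M _ bf fM cf].
- apply: trig_ext (trig_add (trig_monomial (c * e / 2) (k + l))
    (trig_monomial (c * conjc e / 2) (k - l))) => z.
  have z0 : val z != 0 by rewrite -normr_eq0 (eqP (valP z)) oner_eq0.
  rewrite !expfzDr// -exprz_inv circle_valV.
  have -> : (conjc (val z)) ^ l = conjc (val z ^ l).
    by case: l => n; rewrite ?NegzE -?exprz_inv -?exprnP ?rmorphXn// fmorphV.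
  case: (val z ^ k) (val z ^ l) c e => [a1 a2] [b1 b2] [c1 c2] [e1 e2].
  have -> : (2 : C)^-1 = (2^-1 : R)%:C%C by rewrite rmorphV ?unitfE// rmorphMn.
  by rewrite /=; field.
- by apply: trig_ext (trig_add bf bg) => z; rewrite mulrDr.
have [L L0 cL] := bmeas_gt0_bound (bmeas_trig_monomial c k).
apply: (trig_lim (f_ := fun n z => Re (c * val z ^ k) * f_ n z) (M := L * M)) => //.
  by move=> n z; rewrite normrM ler_pM.
by move=> z; apply: cvgM; [exact: cvg_cst|exact: cf].
Qed.

Lemma trigM f g : trig_closure f -> trig_closure g ->
  trig_closure (fun z => f z * g z).
Proof.
move=> + tg; elim=> [c k|{}f h _ bf _ bh|f_ {}f M _ bf fM cf].
- exact: trig_monomialM.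
- by apply: trig_ext (trig_add bf bh) => z; rewrite mulrDl.
have [L L0 cL] := bmeas_gt0_bound (bmeas_trig tg).
apply: (trig_lim (f_ := fun n z => f_ n z * g z) (M := M * L)) => //.
  by move=> n z; rewrite normrM ler_pM.
by move=> z; apply: cvgM; [exact: cf|exact: cvg_cst].
Qed.

Lemma trigZ a f : trig_closure f -> trig_closure (fun z => a * f z).
Proof. by apply: trigM; exact: trig_cst. Qed.

Lemma trigB f g : trig_closure f -> trig_closure g ->
  trig_closure (fun z => f z - g z).
Proof.
move=> tf tg; apply: trig_ext (trig_add tf (trigZ (-1) tg)) => z.
by rewrite mulN1r.
Qed.

(* Newton-type polynomial iteration increasing to [`|x|] on [-1, 1]. *)
Fixpoint abs_approx (x : R) n : R :=
  if n is n'.+1 then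
    let p := abs_approx x n' in p + 2^-1 * (x * x - p * p)
  else 0.

Lemma abs_approxP (x : R) n : `|x| <= 1 ->
  0 <= abs_approx x n <= `|x| /\
  `|x| - abs_approx x n <= (1 - 2^-1 * `|x|) ^+ n * `|x|.
Proof.
move=> x1; have x0 := normr_ge0 x.
have xx : x * x = `|x| * `|x| by rewrite -!expr2 real_normK ?num_real.
elim: n => [|n [/andP[p0 px] IHn]]; first by rewrite /= lexx x0 expr0 mul1r subr0.
rewrite /= xx; set p := abs_approx x n in p0 px IHn *.
set a := `|x| in x1 x0 p0 px IHn *.
(* One iteration multiplies the error by [1 - (a + p) / 2], which lies between 0 and [1 - a / 2]
   because [0 <= p <= a <= 1]. *)
have e : a - (p + 2^-1 * (a * a - p * p)) = (a - p) * (1 - 2^-1 * (a + p)).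
  by field.
have h1 : 0 <= (a - p) * (1 - 2^-1 * (a + p)) by rewrite mulr_ge0 ?subr_ge0//; lra.
split.
  apply/andP; split; last by rewrite -subr_ge0 e.
  by rewrite addr_ge0// mulr_ge0// ?invr_ge0// subr_ge0 ler_pM.
rewrite e exprSr mulrAC.
have h2 : 0 <= 1 - 2^-1 * a by lra.
apply: (@le_trans _ _ ((a - p) * (1 - 2^-1 * a))); last by rewrite ler_wpM2r.
by rewrite ler_wpM2l ?subr_ge0//; lra.
Qed.

Lemma trig_abs1 f : trig_closure f -> (forall z, `|f z| <= 1) ->
  trig_closure (fun z => `|f z|).
Proof.
move=> tf f1; apply: (trig_lim (f_ := fun n z => abs_approx (f z) n) (M := 1)).
- elim=> [|n IHn] /=; first exact: trig_cst.
  by apply: trig_add => //; apply: trigZ; apply: trigB; apply: trigM.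
- move=> n z; have [/andP[h1 h2] _] := abs_approxP n (f1 z).
  by rewrite ger0_norm// (le_trans h2).
move=> z; set a := `|f z|.
have h0 : (1 - 2^-1 * a) ^+ n * a @[n --> \oo] --> (0 : R).
  have [a0|a0] := eqVneq a 0.
    by rewrite a0; under eq_fun do rewrite mulr0; exact: cvg_cst.
  rewrite -[X in _ --> X](mul0r a); apply: cvgM; last exact: cvg_cst.
  have ap : 0 < a by rewrite lt0r a0 normr_ge0.
  by apply: cvg_expr; have := f1 z; rewrite -/a => a1; rewrite ger0_norm; lra.
have h1 : a - (1 - 2^-1 * a) ^+ n * a @[n --> \oo] --> a.
  by rewrite -[X in _ --> X]subr0; apply: cvgB; [exact: cvg_cst|exact: h0].
apply: squeeze_cvgr h1 (cvg_cst a); apply: nearW => n.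
have [/andP[_ ->] h] := abs_approxP n (f1 z).
by rewrite andbT lerBlDr -lerBlDl.
Qed.

(** Once [f] is scaled into [-1, 1], its positive part [p] takes values in [0, 1] and belongs to the
    class thanks to the absolute value; [1 - (1 - p) ^+ n] tends to 1 where [p > 0] and is 0 where
    [p = 0] and [n > 0]. *)
Lemma trig_indic_gt0 f : trig_closure f -> trig_closure (\1_[set z | 0 < f z]).
Proof.
move=> tf; have [M M0 fM] := bmeas_gt0_bound (bmeas_trig tf).
pose g z := M^-1 * f z.
have tg : trig_closure g by exact: trigZ.
have g1 z : `|g z| <= 1.
  by rewrite normrM gtr0_norm ?invr_gt0// ler_pdivrMl// mulr1.
have tp := trigZ 2^-1 (trig_add tg (trig_abs1 tg g1)).
pose p z := 2^-1 * (g z + `|g z|); rewrite -/p in tp.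
have p01 z : 0 <= p z <= 1.
  have := g1 z; rewrite /p ler_norml => /andP[h1 h2].
  by case: (ger0P (g z)) => h; apply/andP; split; lra.
have p0 z : (0 < p z) = (0 < f z).
  have -> : (0 < f z) = (0 < g z) by rewrite pmulr_rgt0 ?invr_gt0.
  rewrite /p; case: (ltP 0 (g z)) => gz.
    by rewrite gtr0_norm// -mulr2n pmulr_rgt0 ?invr_gt0// pmulrn_lgt0.
  by rewrite ler0_norm// subrr mulr0 ltxx.
apply: (trig_lim (f_ := fun n z => 1 - (1 - p z) ^+ n) (M := 1)).
- move=> n; apply: trigB; first exact: trig_cst.
  elim: n => [|n IHn]; first exact: trig_cst.
  apply: (trig_ext (f := fun z => (1 - p z) * (1 - p z) ^+ n)) => [z|].
    by rewrite exprS.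
  by apply: trigM => //; apply: trigB => //; exact: trig_cst.
- move=> n z; have /andP[h1 h2] := p01 z.
  have h3 : 0 <= 1 - p z by rewrite subr_ge0.
  have h4 : (1 - p z) ^+ n <= 1 by rewrite exprn_ile1// lerBlDr lerDl.
  have h5 : 0 <= (1 - p z) ^+ n by rewrite exprn_ge0.
  by rewrite ger0_norm; lra.
move=> z; rewrite indicE.
case: (boolP (_ \in _)) => [|]; rewrite ?(inE, notin_setE) /= -p0 => pz.
  rewrite -[X in _ --> X]subr0; apply: cvgB; first exact: cvg_cst.
  have /andP[h1 h2] := p01 z.
  by apply: cvg_expr; rewrite ger0_norm; lra.
have pz0 : p z = 0.
  by apply/eqP; rewrite eq_le leNgt (introN idP pz)/=; have /andP[] := p01 z.
rewrite pz0; under eq_fun do rewrite subr0 expr1n subrr; exact: cvg_cst.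
Qed.

Lemma trig_sigma_algebra : sigma_algebra setT [set A | trig_closure (\1_A)].
Proof.
have tC A : trig_closure (\1_A) -> trig_closure (\1_(~` A)).
  move=> tA; apply: trig_ext (trigB (trig_cst 1) tA) => z.
  by rewrite !indicE in_setC; case: (z \in A); rewrite ?subrr ?subr0.
have tI A B : trig_closure (\1_A) -> trig_closure (\1_B) -> trig_closure (\1_(A `&` B)).
  by move=> tA tB; apply: trig_ext (trigM tA tB) => z; rewrite indicI.
have t0 : trig_closure (\1_set0).
  by apply: trig_ext (trig_cst 0) => z; rewrite indic0.
split; [exact: t0|by move=> A tA; rewrite setTD; exact: tC|move=> A tA].
have tU n : trig_closure (\1_(\big[setU/set0]_(i < n) A i)).
  elim: n => [|n IHn]; first by rewrite big_ord0.
  rewrite big_ord_recr/= -[X in \1_X]setCK setCU.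
  exact: (tC _ (tI _ _ (tC _ IHn) (tC _ (tA n)))).
apply: (trig_lim (M := 1) tU).
  by move=> n z; rewrite indicE; case: (_ \in _); rewrite ?normr1 ?normr0.
move=> z; rewrite indicE; case: (boolP (_ \in _)) => [|]; rewrite ?(inE, notin_setE).
  move=> [i _ Aiz]; apply: cvg_near_cst; near=> n.
  rewrite indicE mem_set// -bigcup_mkord; exists i => //=.
  by near: n; exact: nbhs_infty_gt.
move=> nz; apply: cvg_near_cst; apply: nearW => n.
rewrite indicE memNset// => h; apply: nz.
by move: h; rewrite -bigcup_mkord => -[i _ Aiz]; exists i.
Unshelve. all: by end_near. Qed.

(** The sets whose indicator is in the class form a sigma-algebra for which every function of the
    class is measurable, by [trig_indic_gt0]. The two coordinates of the plane are in the class, so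
    this sigma-algebra contains the open sets. *)
Lemma trig_indic (A : set circleB) : measurable A -> trig_closure (\1_A).
Proof.
pose G := [set A : set circleB | trig_closure (\1_A)].
have GE : <<s G >> = G by apply: sigma_algebra_id; exact: trig_sigma_algebra.
suff sub : @circle_open R `<=` G.
  by move=> mA; exact: (smallest_sub trig_sigma_algebra sub mA).
have mf (f : circleB -> R) : trig_closure f ->
    measurable_fun (T := g_sigma_algebraType G) setT f.
  move=> tf; apply: (measurability _ (RGenOInfty.measurableE R)) => //.
  move=> _ [_ [a ->] <-]; rewrite setTI; apply: sub_sigma_algebra.
  have := trig_indic_gt0 (trigB tf (trig_cst a)).
  congr trig_closure; congr (\1_ _); apply/seteqP; split => z /=;
    by rewrite in_itv/= andbT subr_gt0.
move=> _ [U oU <-]; rewrite -GE.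
apply: (measurable_preimage_open2 (T := g_sigma_algebraType G)) => //.
  by apply: mf; apply: trig_ext (trig_monomial 1 1) => z; rewrite mul1r expr1z.
(* The coefficient is [- i], since [Re (- i * z) = Im z]. *)
apply: mf; apply: trig_ext (trig_monomial (Complex 0 (-1)) 1) => z.
by rewrite expr1z; case: (val z) => a b /=; ring.
Qed.

Local Notation meas := {finite_measure set circleB -> \bar R}.

Lemma Rint_trig_monomial (m : meas) (c : C) (k : int) :
  Rintegral m setT (fun z => Re (c * val z ^ k)) =
  Re (c * cintegral m (fun z : circleB => val z ^ k)).
Proof.
have [b1 b2] := cbmeas_circle_exprz (R := R) k.
rewrite (eq_Rint m (fun z => ReM c _)) RintB; [|exact: bmeasZ..].
by rewrite !RintZ// /cintegral; case: c.
Qed.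

(** The form with a finite real combination of measures stands in for signed measures, as the
    polarization argument needs it. *)
Lemma fourier_uniqueness (s : seq (R * meas)) :
  (forall k : int, \sum_(p <- s)
    p.1%:C%C * cintegral p.2 (fun z : circleB => val z ^ k) = 0) ->
  forall A, measurable A -> \sum_(p <- s) p.1 * fine (p.2 A) = 0.
Proof.
move=> s0 A mA.
have : trig_closure (\1_A) -> \sum_(p <- s) p.1 * Rintegral p.2 setT (\1_A) = 0.
  move: (\1_A : circleB -> R) => f.
  elim=> [c k|{}f g tf If tg Ig|f_ {}f M tf If fM cf].
  - rewrite -[RHS](_ : Re (c * 0) = 0); last by rewrite mulr0.
    have Re_sum (F : R * meas -> C) :
        Re (\sum_(p <- s) F p) = \sum_(p <- s) Re (F p).
      elim: (s) => [|p s' IHs]; first by rewrite !big_nil.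
      by rewrite !big_cons -IHs; case: (F p) (\sum_(_ <- _) _) => [? ?] [? ?].
    rewrite -(s0 k) mulr_sumr Re_sum.
    apply: eq_bigr => -[a m] _ /=.
    rewrite Rint_trig_monomial; case: c (cintegral _ _) => [c1 c2] [e1 e2] /=; ring.
  - rewrite -[RHS](addr0 0) -[X in _ = X + _]If -[X in _ = _ + X]Ig.
    rewrite -big_split; apply: eq_bigr => p _ /=.
    by rewrite RintD ?mulrDr//; exact: bmeas_trig.
  have : \sum_(p <- s) p.1 * Rintegral p.2 setT (f_ n) @[n --> \oo]
      --> \sum_(p <- s) p.1 * Rintegral p.2 setT f.
    elim: s {s0 If} => [|p s IHs].
      by rewrite big_nil; under eq_fun do rewrite big_nil; exact: cvg_cst.
    rewrite big_cons; under eq_fun do rewrite big_cons.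
    apply: cvgD IHs; apply: cvgM; first exact: cvg_cst.
    by apply: (cvg_Rint (M := M)) => // n; exact: bmeas_trig.
  move=> /cvg_lim <-//; under eq_fun do rewrite If.
  exact: lim_cst.
move=> h; rewrite -[RHS]h; last exact: trig_indic.
by apply: eq_bigr => p _; rewrite Rint_indic.
Qed.

End TrigClosure.

(** * Stationary sequences and singular spectral measures *)

Section Stationary.
Context {R : realType} {d} {T : measurableType d}.
Variable m : {finite_measure set T -> \bar R}.
Local Notation E f := (Rintegral m setT f).

Definition stationary (X : int -> T -> R) (r : int -> R) :=
  (forall a, bmeas (X a)) /\
  forall a b, E (fun x => X a x * X b x) = r (a - b).

Lemma stationary_sym X r : stationary X r -> forall k, r (- k) = r k.
Proof.
move=> [_ rX] k; have := rX 0 k; rewrite sub0r => <-.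
have := rX k 0; rewrite subr0 => <-.
by apply: eq_Rint => x; rewrite mulrC.
Qed.

(** The double sum is the squared norm of [\sum_a exp (i a t) X_a], that is, the sum of the squared
    norms of its cosine and sine parts. *)
Lemma stationary_pos X r : stationary X r -> forall (N : nat) (t : R),
  0 <= \sum_(a < N) \sum_(b < N) r (a%:Z - b%:Z) * cos ((a%:Z - b%:Z)%:~R * t).
Proof.
move=> [bX rX] N t.
pose P (f : R -> R) x := \sum_(a < N) f (a%:R * t) * X a x.
have bP f : bmeas (P f) by apply: bmeas_sum => a _; exact: bmeasZ.
have EP f : E (fun x => P f x * P f x) = \sum_(a < N) \sum_(b < N)
    r (a%:Z - b%:Z) * (f (a%:R * t) * f (b%:R * t)).
  transitivity (E (fun x => \sum_(a < N) \sum_(b < N)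
      (f (a%:R * t) * f (b%:R * t)) * (X a x * X b x))).
    apply: eq_Rint => x; rewrite /P mulr_suml; apply: eq_bigr => a _.
    by rewrite mulr_sumr; apply: eq_bigr => b _; rewrite mulrACA.
  rewrite Rint_sum => [|a _]; last first.
    by apply: bmeas_sum => b _; apply: bmeasZ; exact: bmeasM.
  apply: eq_bigr => a _; rewrite Rint_sum => [|b _]; last first.
    by apply: bmeasZ; exact: bmeasM.
  by apply: eq_bigr => b _; rewrite RintZ ?rX 1?mulrC//; exact: bmeasM.
have -> : \sum_(a < N) \sum_(b < N) r (a%:Z - b%:Z) * cos ((a%:Z - b%:Z)%:~R * t) =
    E (fun x => P cos x * P cos x) + E (fun x => P sin x * P sin x).
  rewrite !EP -big_split; apply: eq_bigr => a _ /=.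
  rewrite -big_split; apply: eq_bigr => b _ /=.
  by rewrite -mulrDr intrB mulrBl cosB.
by rewrite addr_ge0// Rint_ge0// => x; rewrite -expr2 sqr_ge0.
Qed.

Lemma stationary_spectral X r : stationary X r ->
  exists sigma : {finite_measure set (circleB R) -> \bar R},
  forall k : int, cintegral sigma (fun z : circleB R => val z ^ k) = (r k)%:C%C.
Proof.
by move=> sX; exact: herglotz (stationary_sym sX) (stationary_pos sX).
Qed.

(** Divide by [t] and let [t] tend to 0. For a given [e] the value [e / (g + 1)] is small enough,
    and the 1 allows for [g = 0]. *)
Lemma eq0_of_le_mul (x g : R) : (forall t, 0 < t -> t * `|x| <= t * t * g) -> x = 0.
Proof.
move=> h; apply/eqP; rewrite -normr_le0; apply/ler_addgt0Pr => e e0; rewrite add0r.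
have g0 : 0 <= g.
  by have := h 1 ltr01; rewrite !mul1r; apply: le_trans.
have := h (e / (g + 1)); rewrite divr_gt0 ?ltr_wpDl// => /(_ isT).
rewrite -mulrA ler_pM2l ?divr_gt0 ?ltr_wpDl// => /le_trans; apply.
by rewrite mulrAC ler_pdivrMr ?ltr_wpDl// ler_pM2l// lerDl.
Qed.

(* Polarization: with [alpha t] the spectral measure of [F + t G], one has
   [alpha t + alpha (-t) = 2 (sF + t^2 sG)], and [alpha t - alpha (-t)] is
   linear in [t]; letting [t] tend to 0 on a set carrying sG but not sF, and to
   infinity on its complement, shows that [alpha 1 - alpha (-1)] vanishes. *)
Lemma singular_orthogonal F G rF rG c
    (sF sG : {finite_measure set (circleB R) -> \bar R}) :
  stationary F rF -> stationary G rG ->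
  (forall a b, E (fun x => F a x * G b x) = c (a - b)) ->
  (forall k : int, cintegral sF (fun z : circleB R => val z ^ k) = (rF k)%:C%C) ->
  (forall k : int, cintegral sG (fun z : circleB R => val z ^ k) = (rG k)%:C%C) ->
  mutually_singular sF sG -> c 0 = 0.
Proof.
move=> sX sY cE sFE sGE [A [mA FA0 GA0]].
pose X t a x := F a x + t * G a x.
pose r t k := rF k + t * t * rG k + t * (c k + c (- k)).
have [[bF rFE] [bG rGE]] := (sX, sY).
have sXt t : stationary (X t) (r t).
  split=> [a|a b]; first by apply: bmeasD => //; exact: bmeasZ.
  have bFF := bmeasM (bF a) (bF b); have bGG := bmeasM (bG a) (bG b).
  have bFG := bmeasM (bF a) (bG b); have bGF := bmeasM (bF b) (bG a).
  transitivity (E (fun x => F a x * F b x + (t * t) * (G a x * G b x) +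
      (t * (F a x * G b x + F b x * G a x)))).
    by apply: eq_Rint => x; rewrite /X; ring.
  rewrite RintD; [|by apply: bmeasD => //; exact: bmeasZ|by apply: bmeasZ; exact: bmeasD].
  rewrite RintD//; last exact: bmeasZ.
  rewrite (RintZ _ (t * t))// (RintZ _ t); last exact: bmeasD.
  by rewrite RintD// rFE rGE !cE /r opprB.
have [alpha alphaE] : exists alpha : R -> {finite_measure set (circleB R) -> \bar R},
    forall t (k : int), cintegral (alpha t) (fun z : circleB R => val z ^ k) =
      (r t k)%:C%C.
  have /choice[alpha alphaE] := fun t => stationary_spectral (sXt t).
  by exists alpha.
pose a t B := fine (alpha t B).
have a0 t B : 0 <= a t B by exact: fine_ge0.
have sum_a t B : measurable B ->
    a t B + a (- t) B = 2 * fine (sF B) + 2 * (t * t) * fine (sG B).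
  move=> mB; have := @fourier_uniqueness _ [:: (1, alpha t); (1, alpha (- t));
    (-2, sF); (- (2 * (t * t)), sG)] _ B mB.
  rewrite !big_cons big_nil/= -/(a _ _) -/(a _ _) => H.
  apply/eqP; rewrite -subr_eq0 -[X in _ == X]H; first by apply/eqP; ring.
  move=> k; rewrite !big_cons big_nil/= !alphaE sFE sGE -!rmorphM -!rmorphD addr0.
  by apply: (congr1 (real_complex R) (y := 0)); rewrite /r; ring.
have diff_a t B : measurable B ->
    a t B - a (- t) B = t * (a 1 B - a (- 1) B).
  move=> mB; have := @fourier_uniqueness _ [:: (1, alpha t); (-1, alpha (- t));
    (- t, alpha 1); (t, alpha (- 1))] _ B mB.
  rewrite !big_cons big_nil/= -!/(a _ _) => H.
  apply/eqP; rewrite -subr_eq0 -[X in _ == X]H; first by apply/eqP; ring.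
  move=> k; rewrite !big_cons big_nil/= !alphaE -!rmorphM -!rmorphD addr0.
  by apply: (congr1 (real_complex R) (y := 0)); rewrite /r; ring.
have bound t B : 0 < t -> measurable B ->
    t * `|a 1 B - a (- 1) B| <= 2 * fine (sF B) + 2 * (t * t) * fine (sG B).
  move=> t0 mB; rewrite -[X in X * _]gtr0_norm// -normrM -diff_a// -sum_a//.
  by rewrite (le_trans (ler_normB _ _))// !ger0_norm.
have mCA : measurable (~` A) by exact: measurableC.
have d1 : a 1 A - a (- 1) A = 0.
  apply: (@eq0_of_le_mul _ (2 * fine (sG A))) => t t0.
  by have := bound t A t0 mA; rewrite FA0/= mulr0 add0r -mulrA mulrCA.
(* Here [sG] vanishes, and [bound] is used at [t^-1], so that the limit at infinity again takes the
   form of a limit at 0. *)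
have d2 : a 1 (~` A) - a (- 1) (~` A) = 0.
  apply: (@eq0_of_le_mul _ (2 * fine (sF (~` A)))) => t t0.
  have ti0 : 0 < t^-1 by rewrite invr_gt0.
  have := bound t^-1 (~` A) ti0 mCA; rewrite GA0/= mulr0 addr0 ler_pdivrMl// => h.
  by rewrite -mulrA ler_pM2l.
have total t : r t 0 = a t A + a t (~` A).
  have := alphaE t 0; rewrite /cintegral => /(congr1 (@complex.Re R))/= <-.
  rewrite (eq_Rint _ (g := fun=> 1)); last by [].
  rewrite Rint_cst mul1r -fineD ?fin_num_measure// -measureU ?setICr//.
  by rewrite setUCr.
(* The total masses of [alpha 1] and [alpha (- 1)] agree, while [r 1 0 - r (- 1) 0 = 4 * c 0]. *)
have := total (- 1); have := total 1; rewrite /r oppr0; lra.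
Qed.

End Stationary.

(** * Wiener's lemma *)

Section Wiener.
Context {R : realType}.
Local Notation C := R[i].
Local Notation Re := complex.Re.

(** The geometric sums stay bounded by [2 / |1 - q|]. *)
Lemma cesaro_circle (q : circleB R) : val q != 1 ->
  cesaro (fun k => Re (val q ^+ k)) n @[n --> \oo] --> (0 : R).
Proof.
move=> q1; pose K := complex.Re `|1 - val q|.
have KE : `|1 - val q| = K%:C%C by rewrite RRe_real// normr_real.
have K0 : 0 < K by rewrite -ltcR -KE normr_gt0 subr_eq0 eq_sym.
have bd n : `|\sum_(k < n.+1) Re (val q ^+ k)| <= 2 / K.
  rewrite ler_pdivlMr// -lecR rmorphM/= -KE.
  have Re_sum (F : nat -> C) : \sum_(k < n.+1) Re (F k) = Re (\sum_(k < n.+1) F k).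
    elim: n.+1 => [|l IHl]; first by rewrite !big_ord0.
    by rewrite !big_ord_recr/= IHl; case: (F l) (\sum_(_ < _) _) => [? ?] [? ?].
  rewrite (Re_sum (fun k => val q ^+ k)).
  apply: (@le_trans _ _ (`|\sum_(k < n.+1) val q ^+ k| * `|1 - val q|)).
    by rewrite ler_wpM2r// normc_ge_Re.
  rewrite -normrM mulrC -normrN -mulNr opprB -subrX1.
  rewrite (le_trans (ler_normB _ _))// normrX (eqP (valP q)) expr1n normr1.
  by rewrite -[(1 : C)](rmorph1 (real_complex R)) -rmorphD lecR.
have h : 2 / K * n.+1%:R^-1 @[n --> \oo] --> (0 : R).
  rewrite -[X in _ --> X](mulr0 (2 / K)).
  by apply: cvgM; [exact: cvg_cst|exact: cvg_harmonic].
have hN : - (2 / K * n.+1%:R^-1) @[n --> \oo] --> (0 : R).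
  by rewrite -[X in _ --> X]oppr0; apply: cvgN.
apply: squeeze_cvgr hN h; apply: nearW => n.
rewrite -ler_norml /cesaro normrM gtr0_norm ?invr_gt0// mulrC.
by rewrite ler_wpM2r// invr_ge0.
Qed.

(** The averages of [(conjc z * w) ^+ k] over [k] converge boundedly to the indicator of [z] as a
    function of [w], so their integrals tend to the mass of [z]. These integrals are averages of the
    [r k] with weights of modulus at most 1. The same limit shows that points are measurable. *)
Lemma wiener (sigma : {finite_measure set (circleB R) -> \bar R}) (r : int -> R) :
  (forall k : int, cintegral sigma (fun z : circleB R => val z ^ k) = (r k)%:C%C) ->
  cesaro (fun k => `|r (Posz k)|) n @[n --> \oo] --> (0 : R) ->
  continuous_measure sigma.
Proof.
move=> sE r0 z.
have zb1 : `|conjc (val z)| == 1 by rewrite normcJ (eqP (valP z)).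
pose zb : circleB R := exist _ (conjc (val z)) zb1.
pose u n (w : circleB R) := cesaro (fun k => Re (val zb ^+ k * val w ^ Posz k)) n.
have bmono k : bmeas (fun w : circleB R => Re (val zb ^+ k * val w ^ Posz k)).
  exact: (bmeas_trig_monomial (val zb ^+ k) (Posz k)).
have bu n : bmeas (u n).
  by rewrite /u /cesaro; apply: bmeasZ; apply: bmeas_sum => k _; exact: bmono.
have Re_le1 (w : C) : `|w| = 1 -> `|Re w| <= 1.
  by move=> w1; have := normc_ge_Re w; rewrite w1 -(rmorph1 (real_complex R)) lecR.
have u1 n w : `|u n w| <= 1.
  apply: cesaro_bound => k; apply: Re_le1.
  by rewrite normrM !normrX (eqP (valP w)) normcJ (eqP (valP z)) !expr1n mulr1.
have cu w : u n w @[n --> \oo] --> (\1_[set z] w : R).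
  have uE n : u n w = cesaro (fun k => Re ((val zb * val w) ^+ k)) n.
    by congr (_ * _); apply: eq_bigr => k _; rewrite exprMn.
  under eq_fun do rewrite uE.
  rewrite indicE.
  case: (boolP (_ \in _)) => [|]; rewrite ?(inE, notin_setE) /= => wz.
    have q1 : val zb * val w = 1.
      rewrite wz /= -circle_valV mulVf// -normr_eq0.
      by rewrite (eqP (valP z)) oner_eq0.
    rewrite (_ : (fun n => _) = fun=> 1); first exact: cvg_cst.
    apply/funext => n; rewrite /cesaro.
    under eq_bigr do rewrite q1 expr1n.
    by rewrite sumr_const card_ord mulVf.
  apply: (cesaro_circle (q := circle_mul zb w)).
  apply/negP => /eqP /= q1; apply: wz; apply/val_inj.
  have z0 : val z != 0 by rewrite -normr_eq0 (eqP (valP z)) oner_eq0.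
  by apply: (mulfI (x := (val z)^-1)); rewrite ?invr_eq0// mulVf// circle_valV.
have b1 : bmeas (\1_[set z] : circleB R -> R) by exact: bmeas_cvg bu u1 cu.
have mz : measurable ([set z] : set (circleB R)).
  by have [mi _] := b1; apply/measurable_indicP; exact: mi.
have Eu n : Rintegral sigma setT (u n) =
    cesaro (fun k => Re (val zb ^+ k) * r (Posz k)) n.
  rewrite /u /cesaro RintZ; last by apply: bmeas_sum => k _; exact: bmono.
  rewrite Rint_sum => [|k _]; last exact: bmono.
  congr (_ * _); apply: eq_bigr => k _; rewrite Rint_trig_monomial sE.
  by rewrite ReM /= mulr0 subr0.
have c1 := cvg_Rint (m := sigma) bu u1 cu.
have c0 : Rintegral sigma setT (u n) @[n --> \oo] --> (0 : R).
  have r0N : - cesaro (fun k => `|r (Posz k)|) n @[n --> \oo] --> (0 : R).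
    by rewrite -[X in _ --> X]oppr0; apply: cvgN.
  apply: squeeze_cvgr r0N r0; apply: nearW => n.
  rewrite -ler_norml Eu /cesaro normrM gtr0_norm ?invr_gt0// ler_wpM2l ?invr_ge0//.
  apply: le_trans (ler_norm_sum _ _ _) _; apply: ler_sum => k _.
  rewrite normrM ler_piMl// Re_le1// normrX normcJ (eqP (valP z)) expr1n.
  by [].
have := cvg_unique _ c1 c0; rewrite Rint_indic// => s0.
by rewrite -[LHS]fineK ?fin_num_measure// s0.
Qed.

End Wiener.

(** * Weak mixing *)

Section AutIter.
Context {R : realType} {d} {X : measurableType d} {mu : probability X R}.
Variable T : automorphism mu.

Lemma aut_iterS k x : aut_iter T (k + 1) x = T (aut_iter T k x).
Proof.
case: k => [n|[|n]]; first by rewrite addrC -intS.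
  by rewrite NegzE addNr/= aut_invK.
have -> : Negz n.+1 + 1 = Negz n :> int by rewrite !NegzE; lia.
by rewrite [in RHS]/= aut_invK.
Qed.

Lemma aut_iterD a b x : aut_iter T (a + b) x = aut_iter T a (aut_iter T b x).
Proof.
have stepN k y : aut_iter T (k - 1) y = aut_inv T (aut_iter T k y).
  by rewrite -[in RHS](subrK 1 k) aut_iterS aut_funK.
elim/int_rect: a => [|n IHn|n IHn]; first by rewrite add0r.
  have -> : n.+1%:Z + b = n%:Z + b + 1 by lia.
  by rewrite aut_iterS IHn.
have -> : - n.+1%:Z + b = - n%:Z + b - 1 by lia.
have -> : - n.+1%:Z = - n%:Z - 1 by lia.
by rewrite !stepN IHn.
Qed.

Lemma measurable_aut_iter k : measurable_fun setT (aut_iter T k).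
Proof.
case: k => n /=; first exact: measurable_iter (measurable_aut_fun T) n.
exact: measurable_iter (measurable_aut_inv T) n.+1.
Qed.

Lemma aut_iter_preserving k A : measurable A -> mu (aut_iter T k @^-1` A) = mu A.
Proof.
move=> mA.
have preim (f : X -> X) B : measurable_fun setT f -> measurable B ->
    measurable (f @^-1` B).
  by move=> mf mB; rewrite -[X in measurable X]setTI; exact: mf.
have iter_pres (f : X -> X) n : measurable_fun setT f ->
    (forall B, measurable B -> mu (f @^-1` B) = mu B) ->
    mu (iter n f @^-1` A) = mu A.
  move=> mf pf; elim: n => // n IHn.
  rewrite -[RHS]IHn -[RHS]pf; last exact: preim (measurable_iter mf n) mA.
  by congr (mu _); apply/seteqP; split=> x /=; rewrite -iterSr.
case: k => n /=.
  by apply: (iter_pres T n); [exact: measurable_aut_fun|exact: aut_preserving].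
apply: (iter_pres (aut_inv T) n.+1); first exact: measurable_aut_inv.
move=> B mB; rewrite -[LHS](aut_preserving T); last exact: preim (measurable_aut_inv T) mB.
by congr (mu _); apply/seteqP; split=> x /=; rewrite aut_funK.
Qed.

Lemma Rint_aut_iter (f g : X -> R) a b : bmeas f -> bmeas g ->
  Rintegral mu setT (fun x => f (aut_iter T a x) * g (aut_iter T b x)) =
  Rintegral mu setT (fun x => f (aut_iter T (a - b) x) * g x).
Proof.
move=> bf bg.
rewrite [RHS](@Rint_pushforward _ _ _ _ _ mu mu (aut_iter T b)).
- by apply: eq_Rint => x; rewrite -aut_iterD subrK.
- exact: measurable_aut_iter.
- by move=> A mA; exact/esym/aut_iter_preserving.
- by apply: bmeasM => //; apply: (bmeas_comp bf); exact: measurable_aut_iter.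
Qed.

Lemma bmeas_aut_iter (f : X -> R) a : bmeas f -> bmeas (fun x => f (aut_iter T a x)).
Proof. by move=> bf; apply: (bmeas_comp bf); exact: measurable_aut_iter. Qed.

Lemma stationary_aut_iter (f : X -> R) : bmeas f ->
  stationary mu (fun a x => f (aut_iter T a x))
    (fun k => Rintegral mu setT (fun x => f (aut_iter T k x) * f x)).
Proof.
by move=> bf; split=> [a|a b]; [exact: bmeas_aut_iter|exact: Rint_aut_iter].
Qed.

Lemma preserving_prod_map A : measurable A ->
  (mu \x mu)%E (prod_map T T @^-1` A) = (mu \x mu)%E A.
Proof.
have mT := measurable_aut_fun T.
have mTT : measurable_fun setT (prod_map T T).
  by apply: measurable_fun_pair; exact: measurableT_comp.
have [m' m'E] := @finite_pushforward R _ _ _ _ ((mu \x mu)%E : probability _ R) _ mTT.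
move=> mA; rewrite -[LHS]m'E; apply/esym.
apply: (product_measure_unique (m1 := mu) (m2 := mu)) => // B C mB mC.
transitivity ((mu \x mu)%E ((T @^-1` B) `*` (T @^-1` C))).
  rewrite [LHS]m'E; apply: (congr1 (mu \x mu)%E).
  by apply/seteqP; split=> -[x y].
have mpre D : measurable D -> measurable (T @^-1` D).
  by move=> mD; rewrite -[X in measurable X]setTI; exact: mT.
rewrite product_measure1E; [|exact: mpre|exact: mpre].
by congr (_ * _)%E; exact: aut_preserving.
Qed.

(** The square of the correlation of [h] and [u] is the correlation of their tensor squares under
    [T] times [T]. That map is ergodic, so the squares average to a limit containing the factor
    [E h], which is 0. *)
Lemma weak_mixing_decay (h u : X -> R) : weakly_mixing T -> bmeas h -> bmeas u ->
  Rintegral mu setT h = 0 ->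
  cesaro (fun k => `|Rintegral mu setT (fun x => h (iter k T x) * u x)|) n
    @[n --> \oo] --> (0 : R).
Proof.
move=> wmT bh bu h0.
have mT := measurable_aut_fun T.
have mTT : measurable_fun setT (prod_map T T).
  by apply: measurable_fun_pair; exact: measurableT_comp.
pose tensor (f : X -> R) (p : X * X) := f p.1 * f p.2.
have btensor f : bmeas f -> bmeas (tensor f).
  by move=> bf; apply: bmeasM; apply: bmeas_comp.
pose c k := Rintegral mu setT (fun x => h (iter k T x) * u x).
have me := mean_ergodic mTT preserving_prod_map wmT (btensor _ bh) (btensor _ bu).
have Rint0 : Rintegral (mu \x mu)%E setT (tensor h) = 0.
  by rewrite (@Rint_product _ _ _ _ _ mu mu _ _ bh bh) h0 mul0r.
have iterE k p : iter k (prod_map T T) p = (iter k T p.1, iter k T p.2).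
  by elim: k => [|k IHk]; [case: p|rewrite /= IHk].
have cE k : c k * c k = Rintegral (mu \x mu)%E setT
    (fun p => tensor h (iter k (prod_map T T) p) * tensor u p).
  have bhu : bmeas (fun x => h (iter k T x) * u x).
    by apply: bmeasM => //; apply: (bmeas_comp bh); exact: measurable_iter.
  rewrite /c -(@Rint_product _ _ _ _ _ mu mu _ _ bhu bhu).
  by congr fine; apply: eq_integral => p _; rewrite iterE /tensor/= mulrACA.
have : cesaro (fun k => c k * c k) n @[n --> \oo] --> (0 : R).
  rewrite -[X in _ --> X](mul0r (Rintegral (mu \x mu)%E setT (tensor u))) -{1}Rint0.
  by rewrite (funext cE).
move=> /cvgrPdist_le cc; apply/cvgrPdist_le => e e0.
have e2 : 0 < e / 2 by rewrite divr_gt0.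
apply: filterS (cc ((e / 2) * (e / 2)) (mulr_gt0 e2 e2)) => n.
rewrite !sub0r !normrN.
have cn : 0 <= cesaro (fun k => c k * c k) n.
  by rewrite mulr_ge0 ?invr_ge0// sumr_ge0// => k _; rewrite -expr2 sqr_ge0.
have cn' : 0 <= cesaro (fun k => `|c k|) n.
  by rewrite mulr_ge0 ?invr_ge0// sumr_ge0.
rewrite !ger0_norm// => h1.
apply: (@le_trans _ _ (e / 2 + (e / 2)^-1 * cesaro (fun k => c k * c k) n)); last first.
  rewrite [leRHS](splitr e) lerD2l mulrC ler_pdivrMr//.
(* From squares back to absolute values: either [|c k|] is at most [e / 2], or it is at most its
   square divided by [e / 2]. *)
have le_c k : `|c k| <= e / 2 + (e / 2)^-1 * (c k * c k).
  have -> : c k * c k = `|c k| * `|c k| by rewrite -!expr2 real_normK ?num_real.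
  have [ce|ce] := leP `|c k| (e / 2).
    by rewrite (le_trans ce)// lerDl mulr_ge0 ?invr_ge0 ?mulr_ge0// ltW.
  apply: (@le_trans _ _ ((e / 2)^-1 * (`|c k| * `|c k|))); last by rewrite lerDr ltW.
  by rewrite mulrA ler_peMl// mulrC ler_pdivlMr// mul1r ltW.
apply: (@le_trans _ _ (cesaro (fun k => e / 2 + (e / 2)^-1 * (c k * c k)) n)).
  by rewrite /cesaro ler_pM2l ?invr_gt0//; apply: ler_sum => k _; exact: le_c.
rewrite /cesaro big_split/= mulrDr sumr_const card_ord -mulr_sumr -[e / 2 *+ _]mulr_natl.
by rewrite mulKf// mulrCA lexx.
Qed.

End AutIter.

(** * Joinings *)

(** The factors are exchanged one at a time; [1 <= M] lets a single power of [M] bound all the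
    leftover products. *)
Lemma prod_diff_bound {R : realFieldType} (I : Type) (s : seq I) (a b : I -> R) (M : R) :
  1 <= M -> (forall i, `|a i| <= M) -> (forall i, `|b i| <= M) ->
  `|\prod_(i <- s) a i - \prod_(i <- s) b i| <=
    M ^+ size s * \sum_(i <- s) `|a i - b i|.
Proof.
move=> M1 aM bM; have M0 : 0 <= M by rewrite (le_trans _ M1).
elim: s => [|i s IHs]; first by rewrite !big_nil subrr normr0 mulr0.
rewrite !big_cons /= exprS.
set A := \prod_(j <- s) a j in IHs *; set B := \prod_(j <- s) b j in IHs *.
have B1 : `|B| <= M ^+ size s.
  rewrite /B; elim: (s) => [|j s' IH]; first by rewrite big_nil normr1.
  by rewrite big_cons normrM /= exprS ler_pM.
have -> : a i * A - b i * B = a i * (A - B) + (a i - b i) * B by ring.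
rewrite (le_trans (ler_normD _ _))// !normrM mulrDr addrC lerD//.
  rewrite mulrC ler_wpM2r// (le_trans B1)//.
  by rewrite ler_peMl// exprn_ge0.
by rewrite -mulrA ler_pM.
Qed.

Section Joining.
Context {R : realType} {d} {X : measurableType d} {mu : probability X R}.
Variable T : automorphism mu.
Context {I : finType} {dY : I -> measure_display}.
Context {Y : forall i, measurableType (dY i)}.
Context {nu : forall i, probability (Y i) R}.
Variable S : forall i, automorphism (nu i).
Variable lambda : probability (X * dprod Y)%type R.
Hypothesis joining :
  ergodic_joining mu T (prodm nu) (dprod_map S) lambda.

Let W := prod_map T (dprod_map S).
Let Winv := prod_map (aut_inv T) (dprod_map (fun i => aut_inv (S i))).

Let measurable_prod_dprod_map (f : X -> X) (g : forall i, Y i -> Y i) :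
  measurable_fun setT f -> (forall i, measurable_fun setT (g i)) ->
  measurable_fun setT (prod_map f (dprod_map g) : X * dprod Y -> X * dprod Y).
Proof.
move=> mf mg; apply: measurable_fun_pair; first exact: measurableT_comp.
apply: measurable_to_dprod => i; rewrite /dprod_map.
apply: (measurableT_comp (mg i)).
exact: (measurableT_comp (@measurable_coord _ _ Y i) measurable_snd).
Qed.

Let WK : cancel W Winv.
Proof.
move=> [x y]; rewrite /W /Winv /prod_map /= aut_funK; congr pair.
by apply: functional_extensionality_dep => i; rewrite /dprod_map aut_funK.
Qed.

Let WinvK : cancel Winv W.
Proof.
move=> [x y]; rewrite /W /Winv /prod_map /= aut_invK; congr pair.
by apply: functional_extensionality_dep => i; rewrite /dprod_map aut_invK.
Qed.

Let mW : measurable_fun setT W.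
Proof.
by apply: measurable_prod_dprod_map => [|i]; exact: measurable_aut_fun.
Qed.

Let mWinv : measurable_fun setT Winv.
Proof.
by apply: measurable_prod_dprod_map => [|i]; exact: measurable_aut_inv.
Qed.

Let W_preserving A : measurable A -> lambda (W @^-1` A) = lambda A.
Proof. by have [_ _ h _] := joining; exact: h. Qed.

Let W_ergodic : ergodic lambda W.
Proof. by have [_ _ _ h] := joining. Qed.

Definition joining_aut : automorphism lambda :=
  Build_automorphism WK WinvK mW mWinv W_preserving.

Lemma joining_aut_iter a p : aut_iter joining_aut a p =
  (aut_iter T a p.1, (fun i => aut_iter (S i) a (p.2 i)) : dprod Y).
Proof.
have iterE n f (g : forall i, Y i -> Y i) q : iter n (prod_map f (dprod_map g)) q =
    (iter n f q.1, (fun i => iter n (g i) (q.2 i)) : dprod Y) :> X * dprod Y.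
  by elim: n => [|n IHn] /=; [case: q|rewrite IHn].
by case: a => n; rewrite /aut_iter; exact: iterE.
Qed.

Local Notation E f := (Rintegral lambda setT f).
Local Notation tensor f u :=
  (fun p : X * dprod Y => f p.1 * \prod_i u i (p.2 i)).

Lemma bmeas_dprod (u : forall i, Y i -> R) : (forall i, bmeas (u i)) ->
  bmeas (fun y : dprod Y => \prod_i u i (y i)).
Proof.
move=> bu; apply: (@bmeas_prod _ _ _ _ _ _ (fun i (y : dprod Y) => u i (y i))) => i _.
by apply: (bmeas_comp (bu i)); exact: measurable_coord.
Qed.

Lemma bmeas_tensor (f : X -> R) (u : forall i, Y i -> R) :
  bmeas f -> (forall i, bmeas (u i)) -> bmeas (tensor f u).
Proof.
move=> bf bu; apply: bmeasM; first by apply: (bmeas_comp bf); exact: measurable_fst.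
by apply: (bmeas_comp (bmeas_dprod bu)); exact: measurable_snd.
Qed.

(* [correlated L] says that the pure interaction of the coordinates in [L]
   is seen by [X]: the conditional expectation on the product of the [Y i] of
   some function on [X] has a nonzero component in the tensor product of the
   spaces of mean-zero functions over [i \in L]. *)
Definition correlated (L : {set I}) := exists (f : X -> R) (u : forall i, Y i -> R),
  [/\ bmeas f, forall i, bmeas (u i),
      forall i, i \in L -> Rintegral (nu i) setT (u i) = 0,
      forall i, i \notin L -> u i = fun=> 1 & E (tensor f u) != 0].

Lemma correlated0 : correlated finset.set0.
Proof.
exists (fun=> 1), (fun i _ => 1); split.
- exact: bmeas_cst.
- by move=> i; exact: bmeas_cst.
- by move=> i; rewrite inE.
- by [].
rewrite (eq_Rint _ (g := fun=> 1)); last by move=> p; rewrite big1// mulr1.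
rewrite Rint_cst mul1r [X in X != 0](_ : _ = 1) ?oner_neq0//.
exact: (congr1 fine (probability_setT lambda)).
Qed.

Lemma correlatedU J K : (forall i, weakly_mixing (S i)) ->
  correlated J -> correlated K -> correlated (J :|: K).
Proof.
move=> wmS [f [u [bf bu u0 u1 fu]]] [g [h [bg bh h0 h1 gh]]].
apply: contrapT => nJK.
pose c i m := Rintegral (nu i) setT (fun y => h i (iter m (S i) y) * u i y).
pose b i m : R := if i \in J :&: K then c i m else 0.
pose w m i y := h i (iter m (S i) y) * u i y.
pose v m i y := w m i y - b i m.
have bw m i : bmeas (w m i).
  apply: bmeasM => //; apply: (bmeas_comp (bh i)).
  exact: measurable_iter (measurable_aut_fun _) m.
have bv m i : bmeas (v m i) by apply: bmeasB => //; exact: bmeas_cst.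
have mnu i : fine (nu i setT) = 1 by rewrite probability_setT.
pose F m x := g (iter m T x) * f x.
(* [tensor (F m) (w m)] has average correlation [E (tensor f u) * E (tensor g h)],
   and [v m], which is [w m] recentred on [J :&: K], is close to [w m] for most
   [m] by weak mixing. *)
have bF m : bmeas (F m).
  apply: bmeasM => //; apply: (bmeas_comp bg).
  exact: measurable_iter (measurable_aut_fun _) m.
have v0 m : E (tensor (F m) (v m)) = 0.
  apply/eqP; apply: contrapT => /negP ne; apply: nJK.
  exists (F m), (v m); split => //= i.
    (* On [J :&: K] the mean vanishes by the recentring. On [J] alone [h i] is 1 and the factor is
       [u i]; on [K] alone [u i] is 1 and the factor is [h i] moved by [S i], which keeps its
       mean. *)
    rewrite !inE => JK.
    rewrite RintB//; last exact: bmeas_cst.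
    rewrite Rint_cst mnu mulr1 /b inE; case: ifPn; first by rewrite /c subrr.
    rewrite negb_and subr0 => nJ; move: JK.
    have [iJ|iJ] := boolP (i \in J); have [iK|iK] := boolP (i \in K) => // _.
    - by move: nJ; rewrite iJ iK.
    - by rewrite -(u0 _ iJ); apply: eq_Rint => y; rewrite /w (h1 _ iK) mul1r.
    have mSi := measurable_iter (measurable_aut_fun (S i)) m.
    rewrite -(h0 _ iK) -(Rint_invariant mSi _ (bh i)).
      by apply: eq_Rint => y; rewrite /w (u1 _ iJ) mulr1.
    by move=> B mB; exact: (aut_iter_preserving (S i) (Posz m) mB).
  rewrite !inE negb_or => /andP[iJ iK]; apply/funext => y.
  by rewrite /v /w /b inE (negbTE iJ) (h1 _ iK) (u1 _ iJ) mul1r subr0.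
have [Mf Mf0 fM] := bmeas_gt0_bound bf.
have [Mg Mg0 gM] := bmeas_gt0_bound bg.
have [U UP] : exists U : I -> R, forall i, 0 < U i /\ forall y, `|u i y| <= U i.
  have /choice[U UP] : forall i, exists M, 0 < M /\ forall y, `|u i y| <= M.
    by move=> i; have [M] := bmeas_gt0_bound (bu i); exists M.
  by exists U.
have [H HP] : exists H : I -> R, forall i, 0 < H i /\ forall y, `|h i y| <= H i.
  have /choice[H HP] : forall i, exists M, 0 < M /\ forall y, `|h i y| <= M.
    by move=> i; have [M] := bmeas_gt0_bound (bh i); exists M.
  by exists H.
(* One constant, at least 1, above all factors of [w m] and [v m]; the 2 covers the recentring. *)
pose M : R := 1 + \sum_i 2 * (H i * U i).
have UH0 i : 0 <= H i * U i.
  by have [/ltW ? _] := UP i; have [/ltW ? _] := HP i; rewrite mulr_ge0.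
have M1 : 1 <= M by rewrite lerDl sumr_ge0// => i _; rewrite mulr_ge0.
have UHM i : 2 * (H i * U i) <= M.
  rewrite /M (bigD1 i)//= addrCA lerDl addr_ge0// sumr_ge0// => j _.
  by rewrite mulr_ge0.
have wB m i y : `|w m i y| <= H i * U i.
  by rewrite normrM ler_pM//; [apply: (HP i).2|apply: (UP i).2].
have bB m i : `|b i m| <= H i * U i.
  rewrite /b; case: ifP => _; last by rewrite normr0.
  rewrite (le_trans (Rint_bound _ (bw m i) (wB m i)))//.
  by rewrite mnu mulr1.
have wM m i y : `|w m i y| <= M.
  by rewrite (le_trans (wB m i y))// (le_trans _ (UHM i))// mulr_natl mulr2n lerDl.
have vM m i y : `|v m i y| <= M.
  rewrite (le_trans (ler_normB _ _))// (le_trans _ (UHM i))//.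
  by rewrite mulr_natl mulr2n lerD.
pose e m := E (tensor (F m) (w m)).
have eB m : `|e m| <= Mf * Mg * M ^+ size (index_enum I) * \sum_i `|b i m|.
  have bw' := bmeas_tensor (bF m) (bw m); have bv' := bmeas_tensor (bF m) (bv m).
  have eE : e m = E (fun p => (tensor (F m) (w m)) p - (tensor (F m) (v m)) p).
    by rewrite (RintB lambda bw' bv') v0 subr0.
  have l1 : fine (lambda setT) = 1 by rewrite probability_setT.
  rewrite eE -[leRHS]mulr1 -[X in _ * X]l1.
  apply: (Rint_bound lambda (bmeasB bw' bv')).
  move=> p; rewrite -mulrBr normrM -mulrA ler_pM//.
    by rewrite normrM mulrC ler_pM.
  have := prod_diff_bound (index_enum I) M1
    (fun i => wM m i (p.2 i)) (fun i => vM m i (p.2 i)).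
  move=> /le_trans; apply.
  rewrite [X in _ * X <= _](eq_bigr (fun i => `|b i m|))//.
  by move=> i _; rewrite /v opprB addrCA subrr addr0.
have be i : cesaro (fun m => `|b i m|) n @[n --> \oo] --> (0 : R).
  have [iJK|iJK] := boolP (i \in J :&: K); last first.
    rewrite (_ : (fun n => _) = fun=> 0); first exact: cvg_cst.
    apply/funext => l; rewrite /cesaro big1 ?mulr0// => j _.
    by rewrite /b (negbTE iJK) normr0.
  rewrite (_ : (fun m => `|b i m|) = (fun m => `|c i m|)); last first.
    by apply/funext => m; rewrite /b iJK.
  by move: iJK; rewrite inE => /andP[_ iK]; apply: weak_mixing_decay => //; exact: h0.
have sum0 : \sum_i cesaro (fun m => `|b i m|) n @[n --> \oo] --> (0 : R).
  elim: (index_enum I) => [|i s IHs].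
    rewrite (_ : (fun n => _) = fun=> 0); first exact: cvg_cst.
    by apply/funext => l; rewrite big_nil.
  rewrite (_ : (fun n => _) = (fun n => cesaro (fun m => `|b i m|) n +
      \sum_(j <- s) cesaro (fun m => `|b j m|) n)); last first.
    by apply/funext => l; rewrite big_cons.
  by rewrite -(addr0 (0 : R)); apply: cvgD => //; rewrite addr0.
pose D := Mf * Mg * M ^+ size (index_enum I).
have lim0 : D * \sum_i cesaro (fun m => `|b i m|) n @[n --> \oo] --> (0 : R).
  rewrite -[X in _ --> X](mulr0 D).
  by apply: cvgM => //; exact: cvg_cst.
have lim0N : - (D * \sum_i cesaro (fun m => `|b i m|) n) @[n --> \oo] --> (0 : R).
  by rewrite -[X in _ --> X]oppr0; apply: cvgN.
have ce : cesaro e n @[n --> \oo] --> (0 : R).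
  apply: squeeze_cvgr lim0N lim0; apply: nearW => l.
  rewrite -ler_norml /cesaro normrM gtr0_norm ?invr_gt0//.
  rewrite -mulr_sumr mulrCA ler_pM2l ?invr_gt0// exchange_big/= mulr_sumr.
  rewrite (le_trans (ler_norm_sum _ _ _))//; apply: ler_sum => m _; exact: eB.
have := mean_ergodic mW W_preserving W_ergodic (bmeas_tensor bg bh) (bmeas_tensor bf bu).
have eE m : E (fun p => (tensor g h) (iter m W p) * (tensor f u) p) = e m.
  apply: eq_Rint => p; have := joining_aut_iter (Posz m) p.
  rewrite /aut_iter => ->; rewrite /F /w big_split /=; ring.
rewrite (funext eE) => me.
(* The averages of [e] have two limits: 0, from the assumption that [J :|: K] is not correlated, and
   this product of two nonzero numbers. *)
have /eqP : E (tensor g h) * E (tensor f u) = 0 by apply: (cvg_unique _ me ce).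
by rewrite mulf_eq0 (negbTE gh) (negbTE fu).
Qed.

End Joining.

(** * Fourier coefficients of convolutions *)

Section Convolution.
Context {R : realType} {n : nat}.
Variable nu : 'I_n -> {finite_measure set (circleB R) -> \bar R}.
Local Notation prodC := (dprod (fun _ : 'I_n => circleB R)).

Definition circle_prod (z : prodC) : circleB R :=
  \big[@circle_mul R/circle_one R]_(i < n) z i.

Lemma val_circle_prod (z : prodC) : val (circle_prod z) = \prod_(i < n) val (z i).
Proof. by rewrite /circle_prod (big_morph val (id1 := 1) (op1 := *%R)). Qed.

Lemma measurable_circle_prod : measurable_fun setT circle_prod.
Proof.
have [[mre _] [mim _]] : cbmeas (fun z : prodC => \prod_(i < n) val (z i)).
  apply: (@cbmeas_prod _ _ _ _ _ _ (fun i (z : prodC) => val (z i))) => i _.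
  apply: (@cbmeas_coord _ _ _ (fun _ : 'I_n => circleB R) i (fun w : circleB R => val w)).
  by split; [exact: bmeas_circle_Re|exact: bmeas_circle_Im].
by apply: measurable_to_circle; [move: mre|move: mim]; congr measurable_fun;
  apply/funext => z; rewrite val_circle_prod.
Qed.

(** Characters are multiplicative, so Fubini turns the coefficient of the image of the product
    measure into a product. [conv] is [convolution nu] with its structure of finite measure, over
    which [cintegral] can be taken. *)
Lemma convolution_spectral : exists conv : {finite_measure set (circleB R) -> \bar R},
  (forall A, conv A = convolution nu A) /\
  forall k : int, cintegral conv (fun z : circleB R => val z ^ k) =
    \prod_(i < n) cintegral (nu i) (fun z : circleB R => val z ^ k).
Proof.
have [conv convE] := @finite_pushforward R _ _ _ _ (prodm nu) _ measurable_circle_prod.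
exists conv; split=> // k.
rewrite (@cint_pushforward _ _ _ _ _ (prodm nu) conv _ _ measurable_circle_prod
  (fun A _ => convE A) (cbmeas_circle_exprz k)).
rewrite -(@cint_prodm _ _ _ (fun _ : 'I_n => circleB R) nu (fun _ z => val z ^ k)).
  congr cintegral; apply/funext => z; rewrite val_circle_prod.
  by rewrite (big_morph (fun x : R[i] => x ^ k) (fun x y => expfzMl x y k) (exp1rz _ k)).
by move=> i; exact: cbmeas_circle_exprz.
Qed.

End Convolution.

(** * Size of correlated sets *)

Section JoiningSpectral.
Context {R : realType} {d} {X : measurableType d} {mu : probability X R}.
Variable T : automorphism mu.
Context {I : finType} {dY : I -> measure_display}.
Context {Y : forall i, measurableType (dY i)}.
Context {nu : forall i, probability (Y i) R}.
Variable S : forall i, automorphism (nu i).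
Variable lambda : probability (X * dprod Y)%type R.
Hypothesis joining :
  ergodic_joining mu T (prodm nu) (dprod_map S) lambda.
Hypothesis wmS : forall i, weakly_mixing (S i).

Let W := joining_aut joining.
Local Notation E f := (Rintegral lambda setT f).

Lemma Rint_joining_fst (g : X -> R) : bmeas g ->
  E (fun p => g p.1) = Rintegral mu setT g.
Proof.
move=> bg; apply/esym/Rint_pushforward => //.
by move=> A mA; have [h _ _ _] := joining; exact/esym/h.
Qed.

Lemma Rint_joining_snd (g : dprod Y -> R) : bmeas g ->
  E (fun p => g p.2) = Rintegral (prodm nu) setT g.
Proof.
move=> bg; apply/esym/Rint_pushforward => //.
by move=> A mA; have [_ h _ _] := joining; exact/esym/h.
Qed.

Section Block.
Variable v : forall i, Y i -> R.
Arguments v : clear implicits.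
Hypothesis bv : forall i, bmeas (v i).
Let t i (a : int) := Rintegral (nu i) setT (fun y => v i (aut_iter (S i) a y) * v i y).

Lemma bmeas_dprod_iter a :
  bmeas (fun y : dprod Y => \prod_i v i (aut_iter (S i) a (y i))).
Proof.
apply: (@bmeas_dprod _ _ _ _ (fun i y => v i (aut_iter (S i) a y))) => i.
exact: bmeas_aut_iter.
Qed.

Lemma stationary_dprod :
  stationary (prodm nu) (fun a (y : dprod Y) => \prod_i v i (aut_iter (S i) a (y i)))
    (fun a => \prod_i t i a).
Proof.
split=> [a|a b]; first exact: bmeas_dprod_iter.
transitivity (Rintegral (prodm nu) setT (fun y =>
    \prod_i (v i (aut_iter (S i) a (y i)) * v i (aut_iter (S i) b (y i))))).
  by apply: eq_Rint => y; rewrite big_split.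
rewrite (@Rint_prodm _ _ _ Y nu
  (fun i y => v i (aut_iter (S i) a y) * v i (aut_iter (S i) b y))).
  by apply: eq_bigr => i _; exact: Rint_aut_iter.
by move=> i; apply: bmeasM; exact: bmeas_aut_iter.
Qed.

(** A single mean-zero factor is enough: its correlations decay on average by weak mixing, and those
    of the other factors are bounded. *)
Lemma continuous_spectral_dprod i0 : Rintegral (nu i0) setT (v i0) = 0 ->
  exists sigma : {finite_measure set (circleB R) -> \bar R},
    continuous_measure sigma /\
    forall k : int, cintegral sigma (fun z : circleB R => val z ^ k) =
      (\prod_i t i k)%:C%C.
Proof.
move=> v0; have [sigma sE] := stationary_spectral stationary_dprod.
exists sigma; split=> //; apply: (wiener sE).
have [V VP] : exists V : I -> R, forall i, 0 < V i /\ forall y, `|v i y| <= V i.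
  have /choice[V VP] : forall i, exists M, 0 < M /\ forall y, `|v i y| <= M.
    by move=> i; have [M] := bmeas_gt0_bound (bv i); exists M.
  by exists V.
have tV i a : `|t i a| <= V i * V i.
  have n1 : fine (nu i setT) = 1 by rewrite probability_setT.
  rewrite -[leRHS]mulr1 -[X in _ * X]n1; apply: Rint_bound.
    by apply: bmeasM => //; exact: bmeas_aut_iter.
  by move=> y; rewrite normrM ler_pM//; exact: (VP i).2.
pose B := \prod_(i | i != i0) (V i * V i).
have rB a : `|\prod_i t i a| <= B * `|t i0 a|.
  rewrite (bigD1 i0)//= normrM mulrC ler_wpM2r// normr_prod.
  by apply: ler_prod => i _; rewrite normr_ge0 tV.
have c0 : cesaro (fun k => `|t i0 (Posz k)|) n @[n --> \oo] --> (0 : R).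
  exact: weak_mixing_decay.
have Bc0 : B * cesaro (fun k => `|t i0 (Posz k)|) n @[n --> \oo] --> (0 : R).
  by rewrite -[X in _ --> X](mulr0 B); apply: cvgM => //; exact: cvg_cst.
apply: squeeze_cvgr (cvg_cst _) Bc0; apply: nearW => n.
rewrite mulr_ge0 ?invr_ge0 ?sumr_ge0//=.
rewrite /cesaro mulrCA ler_pM2l ?invr_gt0// mulr_sumr.
by apply: ler_sum => k _; exact: rB.
Qed.

End Block.

(** One measure serves two purposes: as a spectral measure for [T] it is governed by the maximal
    spectral type, and as the spectral measure of [f] lifted to the joining it can be compared with
    that of a function of [y]. *)
Lemma spectral_measure_fst (f : X -> R) : bmeas f ->
  exists sF : {finite_measure set (circleB R) -> \bar R},
  [/\ L2 mu (fun x => (f x)%:C%C), is_spectral_measure T (fun x => (f x)%:C%C) sF &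
    forall k : int, cintegral sF (fun z : circleB R => val z ^ k) =
      (E (fun p => f (aut_iter W k p).1 * f p.1))%:C%C].
Proof.
move=> bf; have [sF sFE] := stationary_spectral (stationary_aut_iter T bf).
exists sF; split.
- split => /=; [by case: bf|exact: measurable_cst|].
  apply: (@bmeas_integrable _ _ _ mu (fun x => f x ^+ 2 + 0 ^+ 2)).
  by apply: bmeasD; [exact: bmeasM|exact: bmeas_cst].
- move=> k; rewrite sFE -cint_real; congr cintegral; apply/funext => x.
  rewrite rmorphM; congr (_ * _); apply/esym/CrealP.
  by rewrite complex_real.
move=> k; rewrite sFE; congr (_%:C)%C.
rewrite -(Rint_joining_fst (g := fun x => f (aut_iter T k x) * f x)).
  by apply: eq_Rint => p; rewrite /W joining_aut_iter.
by apply: bmeasM => //; exact: bmeas_aut_iter.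
Qed.

Lemma correlated_card n L : (0 < n)%N -> CS n T ->
  correlated (nu := nu) lambda L -> (#|L| < n)%N.
Proof.
case: n => // n _ [sigma [[smax _] CSs]] [f [u [bf bu u0 u1 fu]]].
rewrite ltnNge; apply/negP => nL.
(* [c] splits [L] into [n.+1] nonempty blocks, and [v b] is the part of [u] living
   on the block [b]. *)
pose c (i : I) : 'I_n.+1 := inord (minn (index i (enum L)) n).
(* The element of [L] of rank [b] lies in the block [b]. Higher ranks, and all indices outside [L],
   fall into the last block; outside [L] this is harmless because [u i] is 1 there. *)
have c_surj (b : 'I_n.+1) : exists2 i, i \in L & c i = b.
  have [i0 i0L] : exists i, i \in L by apply/card_gt0P; exact: leq_trans nL.
  have bL : (b < size (enum L))%N by rewrite -cardE (leq_trans (ltn_ord b)).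
  exists (nth i0 (enum L) b); first by rewrite -mem_enum mem_nth.
  rewrite /c index_uniq ?enum_uniq// (minn_idPl _) ?inord_val//.
  by rewrite -ltnS.
pose v (b : 'I_n.+1) i := if c i == b then u i else fun=> 1.
have bv b i : bmeas (v b i) by rewrite /v; case: ifP => // _; exact: bmeas_cst.
pose t b i (k : int) :=
  Rintegral (nu i) setT (fun y => v b i (aut_iter (S i) k y) * v b i y).
have [rho rhoP] : exists rho : 'I_n.+1 -> {finite_measure set (circleB R) -> \bar R},
    forall b, continuous_measure (rho b) /\
    forall k : int, cintegral (rho b) (fun z : circleB R => val z ^ k) =
      (\prod_i t b i k)%:C%C.
  have /choice[rho rhoP] : forall b, exists rho : {finite_measure set (circleB R) -> \bar R},
      continuous_measure rho /\
      forall k : int, cintegral rho (fun z : circleB R => val z ^ k) =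
        (\prod_i t b i k)%:C%C.
    move=> b; have [i iL ci] := c_surj b.
    by apply: (continuous_spectral_dprod (bv b) (i0 := i)); rewrite /v ci eqxx u0.
  by exists rho.
have [conv [convE conv_hat]] := convolution_spectral rho.
have [A [mA A0 CA0]] := CSs rho (fun b => (rhoP b).1).
have [sF [L2f sFf sFE]] := spectral_measure_fst bf.
have dom := (null_content_dominatesP _ _).1 (smax _ _ L2f sFf).
pose g (p : X * dprod Y) := \prod_i u i (p.2 i).
have bg : bmeas g.
  by apply: (bmeas_comp (bmeas_dprod bu)); exact: measurable_snd.
have bfst : bmeas (fun p : X * dprod Y => f p.1).
  by apply: (bmeas_comp bf); exact: measurable_fst.
(* The convolution is the spectral measure of the whole product [g]: in the double product over
   blocks and coordinates, a coordinate [i] contributes [u i] in the block [c i] and the integral of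
   1 in every other block. *)
have conv_g (k : int) : cintegral conv (fun z : circleB R => val z ^ k) =
    (E (fun p => g (aut_iter W k p) * g p))%:C%C.
  rewrite conv_hat (eq_bigr (fun b => (\prod_i t b i k)%:C%C)); last first.
    by move=> b _; rewrite (rhoP b).2.
  rewrite -rmorph_prod exchange_big/=; congr (_%:C)%C.
  transitivity (\prod_i Rintegral (nu i) setT (fun y => u i (aut_iter (S i) k y) * u i y)).
    apply: eq_bigr => i _; rewrite (bigD1 (c i))//= big1 => [|b bc].
      by rewrite mulr1 /t /v eqxx.
    rewrite /t /v eq_sym (negbTE bc) (eq_Rint _ (g := fun=> 1)); last first.
      by move=> y; rewrite mulr1.
    by rewrite Rint_cst mul1r; exact: (congr1 fine (probability_setT (nu i))).
  rewrite -(@Rint_prodm _ _ _ Y nu (fun i y => u i (aut_iter (S i) k y) * u i y)); last first.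
    by move=> i; apply: bmeasM => //; exact: bmeas_aut_iter.
  rewrite -Rint_joining_snd; last first.
    apply: (@bmeas_dprod _ _ _ _ (fun i y => u i (aut_iter (S i) k y) * u i y)) => i.
    by apply: bmeasM => //; exact: bmeas_aut_iter.
  by apply: eq_Rint => p; rewrite big_split /g /W joining_aut_iter.
move/eqP: fu; apply.
apply: (singular_orthogonal (stationary_aut_iter W bfst) (stationary_aut_iter W bg)
  (c := fun k => E (fun p => f (aut_iter W k p).1 * g p)) _ sFE conv_g).
  by move=> a b; exact: (Rint_aut_iter W a b bfst bg).
(* [sF] is dominated by [sigma], so it inherits the singularity to the convolution, with the same
   set [A]. *)
by exists A; rewrite convE; split=> //; exact: dom.
Qed.

End JoiningSpectral.

Lemma card_superset (I : finType) (J : {set I}) m : (#|J| <= m <= #|I|)%N ->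
  exists K : {set I}, J \subset K /\ #|K| = m.
Proof.
move=> /andP[Jm mI]; rewrite -(subnK Jm) in mI *.
elim: (m - #|J|)%N mI => [|l IHl] mI; first by exists J.
have [K [JK Kl]] := IHl (ltnW mI).
have /subsetPn[i _ iK] : ~~ (predT \subset K).
  apply/negP => /subset_leq_card; rewrite Kl => /(leq_trans mI).
  by rewrite addSn ltnn.
exists (i |: K)%SET; split; first by rewrite (fintype.subset_trans JK)// finset.subsetUr.
by rewrite cardsU1 iK Kl addSn.
Qed.

(** * Independence of the coordinates outside all correlated sets *)

Section JoiningSplit.
Context {R : realType} {d} {X : measurableType d}.
Context {I : finType} {dY : I -> measure_display}.
Context {Y : forall i, measurableType (dY i)}.
Context {nu : forall i, probability (Y i) R}.
Variable lambda : probability (X * dprod Y)%type R.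
Variable J : {set I}.
Hypothesis correlatedJ : forall L, correlated (nu := nu) lambda L -> L \subset J.

Local Notation E f := (Rintegral lambda setT f).

Lemma Rint_tensor_expand (f : X -> R) (u : forall i, Y i -> R) (b : I -> R) :
  bmeas f -> (forall i, bmeas (u i)) ->
  E (fun p => f p.1 * \prod_i (u i (p.2 i) + b i)) =
  \sum_(L : {set I}) (\prod_i (if i \in L then 1 else b i)) *
    E (fun p => f p.1 * \prod_i (if i \in L then u i else fun=> 1) (p.2 i)).
Proof.
move=> bf bu.
have bL (L : {set I}) : bmeas (fun p : X * dprod Y =>
    f p.1 * \prod_i (if i \in L then u i else fun=> 1) (p.2 i)).
  apply: (@bmeas_tensor _ _ _ _ _ _ f (fun i => if i \in L then u i else fun=> 1)) => // i.
  by case: ifP => // _; exact: bmeas_cst.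
transitivity (E (fun p => \sum_(L : {set I}) (\prod_i (if i \in L then 1 else b i)) *
    (f p.1 * \prod_i (if i \in L then u i else fun=> 1) (p.2 i)))).
  apply: eq_Rint => p; rewrite bigA_distr mulr_sumr; apply: eq_bigr => L _.
  rewrite mulrCA -big_split/=; congr (_ * _); apply: eq_bigr => i _.
  by case: ifP; rewrite ?mul1r ?mulr1.
rewrite Rint_sum => [|L _]; last exact: bmeasZ.
by apply: eq_bigr => L _; rewrite RintZ.
Qed.

(** Write each [g i] as its mean [b i] plus a mean-zero [u i] and expand over the sets [L] of
    coordinates where [u i] is chosen. The terms with [L] not inside [J] vanish and the others do
    not involve [u i] for [i] outside [J], so there [u i] may be replaced by 0, that is, [g i] by
    its mean. *)
Lemma Rint_joining_split (f : X -> R) (g : forall i, Y i -> R) :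
  bmeas f -> (forall i, bmeas (g i)) ->
  E (fun p => f p.1 * \prod_i g i (p.2 i)) =
  E (fun p => f p.1 * \prod_(i in J) g i (p.2 i)) *
    \prod_(i in finset.setC J) Rintegral (nu i) setT (g i).
Proof.
move=> bf bg; pose b i := Rintegral (nu i) setT (g i).
pose u i y := g i y - b i.
have bu i : bmeas (u i) by apply: bmeasB => //; exact: bmeas_cst.
pose u' i := if i \in J then u i else fun=> 0.
have bu' i : bmeas (u' i) by rewrite /u'; case: ifP => // _; exact: bmeas_cst.
have u0 i : Rintegral (nu i) setT (u i) = 0.
  have n1 : fine (nu i setT) = 1 by rewrite probability_setT.
  rewrite RintB//; last exact: bmeas_cst.
  by rewrite Rint_cst n1 mulr1 subrr.
have u'0 i : Rintegral (nu i) setT (u' i) = 0.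
  by rewrite /u'; case: ifP => _; [exact: u0|exact: Rint0].
have vanish (w : forall i, Y i -> R) (L : {set I}) : (forall i, bmeas (w i)) ->
    (forall i, Rintegral (nu i) setT (w i) = 0) -> ~~ (L \subset J) ->
    E (fun p => f p.1 * \prod_i (if i \in L then w i else fun=> 1) (p.2 i)) = 0.
  move=> bw w0 LJ; apply/eqP; apply: contraNT LJ => ne; apply: correlatedJ.
  exists f, (fun i => if i \in L then w i else fun=> 1); split => //.
  - by move=> i; case: ifP => // _; exact: bmeas_cst.
  - by move=> i ->.
  - by move=> i /negbTE ->.
transitivity (E (fun p => f p.1 * \prod_i (u i (p.2 i) + b i))).
  apply: eq_Rint => p; congr (_ * _); apply: eq_bigr => i _.
  by rewrite /u subrK.
transitivity (E (fun p => f p.1 * \prod_i (u' i (p.2 i) + b i))).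
  rewrite !Rint_tensor_expand//; apply: eq_bigr => L _; congr (_ * _).
  have [LJ|LJ] := boolP (L \subset J); last by rewrite !vanish.
  apply: eq_Rint => p; congr (_ * _); apply: eq_bigr => i _.
  by case: ifP => // iL; rewrite /u' (fintype.subsetP LJ).
have bJ : bmeas (fun p : X * dprod Y => f p.1 * \prod_(i in J) g i (p.2 i)).
  apply: bmeasM; first by apply: (bmeas_comp bf); exact: measurable_fst.
  apply: (@bmeas_prod _ _ _ _ _ _ (fun i (p : X * dprod Y) => g i (p.2 i))) => i _.
  apply: (bmeas_comp (bg i)).
  exact: (measurableT_comp (@measurable_coord _ _ Y i) measurable_snd).
rewrite mulrC -RintZ//; apply: eq_Rint => p.
rewrite mulrCA; congr (_ * _).
rewrite (bigID (mem J)) /= mulrC; congr (_ * _).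
  apply: eq_big => [i|i iJ]; first by rewrite inE.
  by rewrite /u' (negbTE iJ) add0r.
by apply: eq_bigr => i iJ; rewrite /u' iJ /u subrK.
Qed.

Let box (P : {pred I}) (A : set X) (B : forall i, set (Y i)) : set (X * dprod Y) :=
  [set p | A p.1 /\ forall i, i \in P -> B i (p.2 i)].

Lemma measurable_box_in (P : {pred I}) A B : measurable A ->
  (forall i, measurable (B i)) -> measurable (box P A B).
Proof.
move=> mA mB; have mB' i : measurable (if i \in P then B i else setT) by case: ifP.
have -> : box P A B =
    A `*` [set y : dprod Y | forall i, (if i \in P then B i else setT) (y i)].
  apply/seteqP; split=> -[x y] /= [Ax h]; split=> // i.
    by case: ifP => // /h.
  by move=> iP; have := h i; rewrite iP.
apply: measurableX => //.
exact: (@measurable_box _ _ Y (fun i => if i \in P then B i else setT)).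
Qed.

Lemma Rint_box (P : {pred I}) A B : measurable A -> (forall i, measurable (B i)) ->
  E (fun p => \1_A p.1 * \prod_(i in P) \1_(B i) (p.2 i)) = fine (lambda (box P A B)).
Proof.
move=> mA mB; rewrite -Rint_indic; last exact: measurable_box_in.
apply: eq_Rint => p; rewrite [RHS]indicE.
have [|] := boolP (p \in box P A B); rewrite ?(inE, notin_setE) /= => h.
  move: h => [Ap h]; rewrite indicE mem_set// mul1r big1// => i iP.
  by rewrite indicE mem_set//; exact: h.
have [Ap|nAp] := pselect (A p.1); last by rewrite indicE memNset// mul0r.
have [i iP nB] : exists2 i, i \in P & ~ B i (p.2 i).
  apply: contrapT => nex; apply: h; split=> // i iP; apply: contrapT => nB.
  by apply: nex; exists i.
by rewrite (bigD1 i)//= indicE [X in _ * (X * _)]indicE (memNset nB) mul0r mulr0.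
Qed.

Lemma joining_box A B : measurable A -> (forall i, measurable (B i)) ->
  lambda (box predT A B) = (lambda (box (mem J) A B) *
    \prod_(i in finset.setC J) nu i (B i))%E.
Proof.
move=> mA mB.
have fin P : lambda (box P A B) \is a fin_num.
  by apply: fin_num_measure; exact: measurable_box_in.
have -> : (\prod_(i in finset.setC J) nu i (B i) =
    (\prod_(i in finset.setC J) fine (nu i (B i)))%:E)%E.
  rewrite (big_morph EFin (id1 := 1%E) (op1 := *%E))//.
  by apply: eq_bigr => i _; rewrite fineK// fin_num_measure.
rewrite -(fineK (fin predT)) -(fineK (fin (mem J))) -EFinM; congr EFin.
rewrite -!Rint_box//.
have h := @Rint_joining_split (\1_A) (fun i => \1_(B i)) (bmeas_indic mA)
  (fun i => bmeas_indic (mB i)).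
transitivity (E (fun p => \1_A p.1 * \prod_i \1_(B i) (p.2 i))).
  by apply: eq_Rint => p; congr (_ * _); exact: eq_bigl.
rewrite h; congr (_ * _); apply: eq_bigr => i _.
by rewrite Rint_indic.
Qed.

Let JC := finset.setC J.
Let Z := ((X * dprod (@subfamily _ _ Y J)) * dprod (@subfamily _ _ Y JC))%type.
Let projJ (p : X * dprod Y) := (p.1, @restr _ _ Y J p.2).
Let regroup (p : X * dprod Y) : Z := (projJ p, @restr _ _ Y JC p.2).

Let measurable_restr (K : {set I}) :
  measurable_fun setT (fun p : X * dprod Y => @restr _ _ Y K p.2).
Proof.
apply: measurable_to_dprod => j; rewrite /restr.
exact: (measurableT_comp (@measurable_coord _ _ Y (val j)) measurable_snd).
Qed.

Let mprojJ : measurable_fun setT projJ.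
Proof.
by apply: measurable_fun_pair; [exact: measurable_fst|exact: measurable_restr].
Qed.

Let mregroup : measurable_fun setT regroup.
Proof. by apply: measurable_fun_pair; [exact: mprojJ|exact: measurable_restr]. Qed.

Let boxes : set (set Z) := [set C | exists (A : set X)
  (a : forall j, set (@subfamily _ _ Y J j)) (b : forall j, set (@subfamily _ _ Y JC j)),
  [/\ measurable A, forall j, measurable (a j), forall j, measurable (b j) &
   C = [set z | [/\ A z.1.1, forall j, a j (z.1.2 j) & forall j, b j (z.2 j)]]]].

Let boxes_measurable : boxes `<=` measurable.
Proof.
move=> _ [A [a [b [mA ma mb ->]]]].
rewrite (_ : [set z | _] =
    (A `*` [set y | forall j, a j (y j)]) `*` [set y | forall j, b j (y j)]).
  by apply: measurableX; [apply: measurableX => //|]; exact: measurable_box.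
by apply/seteqP; split=> -[[x y] y'] /=; [move=> [? ? ?]|move=> [[? ?] ?]].
Qed.

Let boxes_setI : setI_closed boxes.
Proof.
move=> _ _ [A [a [b [mA ma mb ->]]]] [A' [a' [b' [mA' ma' mb' ->]]]].
exists (A `&` A'), (fun j => a j `&` a' j), (fun j => b j `&` b' j); split.
- exact: measurableI.
- by move=> j; exact: measurableI.
- by move=> j; exact: measurableI.
apply/seteqP; split => z /=.
  by move=> [[? ? ?] [? ? ?]]; split=> // j; split.
move=> [[? ?] h1 h2]; split; split=> // j.
- by have [] := h1 j.
- by have [] := h2 j.
- by have [] := h1 j.
- by have [] := h2 j.
Qed.

Let boxes_setT : boxes setT.
Proof.
exists setT, (fun=> setT), (fun=> setT); split=> //.
by apply/seteqP; split.
Qed.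

(* The identity map from [Z] with the sigma-algebra generated by the boxes is
   measurable because its coordinates are. *)
Let boxes_generate (C : set Z) : measurable C -> <<s boxes >> C.
Proof.
move=> mC.
have bsub (D : set Z) : boxes D -> measurable (D : set (g_sigma_algebraType boxes)).
  exact: sub_sigma_algebra.
have mid : measurable_fun (T := g_sigma_algebraType boxes) setT (id : Z -> Z).
  apply/measurable_fun_pairP; split; first (apply/measurable_fun_pairP; split).
  - move=> _ A mA; rewrite setTI; apply: bsub.
    exists A, (fun=> setT), (fun=> setT); split=> //.
    by apply/seteqP; split=> z //= [].
  - apply: measurable_to_dprod => j _ B mB; rewrite setTI; apply: bsub.
    exists setT, (dfwith (fun=> setT) j B), (fun=> setT); split=> // [i|].
      by case: dfwithP.
    apply/seteqP; split=> z /= => [h|[_ h _]]; last by have := h j; rewrite dfwithin.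
    by split=> // i; case: dfwithP.
  - apply: measurable_to_dprod => j _ B mB; rewrite setTI; apply: bsub.
    exists setT, (fun=> setT), (dfwith (fun=> setT) j B); split=> // [i|].
      by case: dfwithP.
    apply/seteqP; split=> z /= => [h|[_ _ h]]; last by have := h j; rewrite dfwithin.
    by split=> // i; case: dfwithP.
by have := mid measurableT C mC; rewrite setTI.
Qed.

(** Two finite measures that agree on the boxes, which are closed under intersection and generate
    the sigma-algebra; the agreement is [joining_box]. *)
Lemma joining_splits_along : splits_along nu lambda J.
Proof.
rewrite /splits_along => C mC.
have [m1 m1E] := @finite_pushforward R _ _ _ _ lambda _ mregroup.
have [m2 m2E] := @finite_pushforward R _ _ _ _ lambda _ mprojJ.
pose nuC := prodm (fun j : {i : I | i \in JC} => nu (val j)).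
have m2f : pushforward lambda projJ = m2 by apply/funext => D; rewrite m2E.
transitivity (m1 C); first by rewrite m1E.
transitivity ((m2 \x nuC)%E C); last by rewrite /= -m2f.
apply: (@g_sigma_algebra_measure_unique _ _ _ boxes boxes_measurable (fun=> setT)) => //.
- by rewrite bigcup_const.
- move=> _ [A [a [b [mA ma mb ->]]]].
  (* The sides [a] over [J] and [b] over its complement are glued into one family over [I].
     Quantifying over the membership proofs avoids a dependent case analysis: of the two conditions
     one is vacuous, and proof irrelevance reduces the other to a single instance. *)
  pose B i : set (Y i) := [set y : Y i | (forall h : i \in J, a (exist _ i h) y) /\
    (forall h : i \in JC, b (exist _ i h) y)].
  have mB i : measurable (B i).
    apply: measurableI.
      have [iJ|iJ] := pselect (i \in J).
        rewrite [X in measurable X](_ : _ = a (exist _ i iJ)); first exact: ma.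
        apply/seteqP; split=> y /= h; first exact: h.
        by move=> iJ'; rewrite (bool_irrelevance iJ' iJ).
      rewrite [X in measurable X](_ : _ = setT)//.
      by apply/seteqP; split=> y // _ /iJ.
    have [iJ|iJ] := pselect (i \in JC).
      rewrite [X in measurable X](_ : _ = b (exist _ i iJ)); first exact: mb.
      apply/seteqP; split=> y /= h; first exact: h.
      by move=> iJ'; rewrite (bool_irrelevance iJ' iJ).
    rewrite [X in measurable X](_ : _ = setT)//.
    by apply/seteqP; split=> y // _ /iJ.
  have BJ i (h : i \in J) : B i = a (exist _ i h).
    apply/seteqP; split=> y /= => [[+ _]|ay]; first exact.
    split=> h'; first by rewrite (bool_irrelevance h' h).
    by exfalso; move: h'; rewrite inE h.
  have BJC i (h : i \in JC) : B i = b (exist _ i h).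
    apply/seteqP; split=> y /= => [[_ +]|ay]; first exact.
    split=> h'; last by rewrite (bool_irrelevance h' h).
    by exfalso; have := h; rewrite inE h'.
  transitivity (lambda (box predT A B)).
    rewrite [LHS]m1E; apply: (congr1 lambda); apply/seteqP; split=> -[x y] /=.
      move=> [Ax h1 h2]; split=> [//|i _].
      exact: conj (fun h => h1 (exist _ i h)) (fun h => h2 (exist _ i h)).
    move=> [Ax h]; split=> // -[i hi]; rewrite /restr /=.
      by have := h i isT; rewrite (BJ _ hi).
    by have := h i isT; rewrite (BJC _ hi).
  rewrite joining_box//.
  transitivity ((m2 \x nuC)%E
      ((A `*` [set y | forall j, a j (y j)]) `*` [set y | forall j, b j (y j)])).
    rewrite product_measure1E; last 2 first.
    - by apply: measurableX => //; exact: measurable_box.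
    - exact: measurable_box.
    congr (_ * _)%E.
      rewrite [RHS]m2E; apply: (congr1 lambda); apply/seteqP; split=> -[x y] /=.
        move=> [Ax h]; split=> // -[i hi]; rewrite /restr /=.
        by have := h i hi; rewrite (BJ _ hi).
      by move=> [Ax h]; split=> // i hi; rewrite (BJ _ hi); exact: (h (exist _ i hi)).
    rewrite [RHS]prodm_box// big_sub; apply: eq_bigr => -[i hi] _ /=.
    by rewrite (BJC _ hi).
  apply: (congr1 (m2 \x nuC)%E).
  by apply/seteqP; split=> -[[x y] y'] /=; [move=> [[? ?] ?]|move=> [? ? ?]].
- by move=> _; rewrite ltey_eq fin_num_measure.
- exact: boxes_generate.
Qed.

End JoiningSplit.

Theorem theorem4p3 (R : realType) (d : measure_display) (X : measurableType d)
    (mu : probability X R) (T : automorphism mu) (n : nat) :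
  standard_borel (R := R) X ->
  ergodic mu T ->
  (2 <= n)%N ->
  CS n T ->
  JP n.-1 T.
Proof.
move=> _ _ n2 csT k nk dY Y nu S _ wmS lambda joining.
have n0 : (0 < n)%N by exact: leq_trans n2.
pose J0 := (\bigcup_(L : {set 'I_k} | `[< correlated (nu := nu) lambda L >]) L)%SET.
have cJ0 : correlated (nu := nu) lambda J0.
  rewrite /J0; elim/big_ind: _ => [|K L cK cL|L /asboolP//]; first exact: correlated0.
  exact: (correlatedU joining).
(* [JP] asks for exactly [n.-1] coordinates. [J0], itself correlated, has at most that many and can
   be enlarged within ['I_k]; the splitting holds along any set containing all correlated ones. *)
have [J [J0J cardJ]] : exists J : {set 'I_k}, J0 \subset J /\ #|J| = n.-1.
  apply: card_superset; rewrite card_ord.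
  rewrite -ltnS prednK// (correlated_card joining wmS n0 csT cJ0)/=.
  exact: ltnW nk.
exists J; split=> //; apply: joining_splits_along => L cL.
apply: fintype.subset_trans J0J; apply: finset.bigcup_sup; exact/asboolP.
Qed.
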